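(* Let $q$ be a prime power, let $k\ge 2$, let $2\le d_1\le d_2\le\dots\le d_{k-1}$ be integers, and let $d\ge 1$ be an integer. Let $X=\{P_1,\dots,P_n\}\subseteq\mathbb{P}^{k-1}(\mathbb{F}_q)$ be the set of points of a zero-dimensional reduced complete intersection defined over $\mathbb{F}_q$ of degrees $d_1,\dots,d_{k-1}$. Let $\mathcal{C}\subseteq\mathbb{F}_q^n$ be the code obtained by evaluating the set of homogeneous forms of degree $d$ in $\mathbb{F}_q[x_1,\dots,x_k]$ at the points of $X$. Then the minimum distance of $\mathcal{C}$ satisfies $$\mathrm{d}_1(\mathcal{C})\ \ge\ (d_1-\min\{d,d_1\})\,d_2\cdots d_{k-1},$$ where the empty product (when $k=2$) equals $1$.
   Context: A linear code over $\mathbb{F}_q$ is a linear subspace $\mathcal{C}\subseteq\mathbb{F}_q^n$. Its minimum distance $\mathrm{d}_1(\mathcal{C})$ is the minimum number of nonzero coordinates of a nonzero codeword of $\mathcal{C}$. Let $\overline{\mathbb{F}}_q$ be an algebraic closure of $\mathbb{F}_q$. A complete intersection of degrees $d_1,\dots,d_t$ in $\mathbb{P}^{k-1}(\overline{\mathbb{F}}_q)$ is the subscheme defined by a regular sequence of homogeneous forms of degrees $d_1,\dots,d_t$ in $\overline{\mathbb{F}}_q[x_1,\dots,x_k]$; it is reduced if the ideal generated by the regular sequence is radical (i.e. equals the vanishing ideal of its zero locus). Thus ''the set of points $X$ of a zero-dimensional reduced complete intersection defined over $\mathbb{F}_q$ of degrees $d_1,\dots,d_{k-1}$'' means: there are homogeneous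 $f_1,\dots,f_{k-1}\in\mathbb{F}_q[x_1,\dots,x_k]$ with $\deg f_i=d_i$, forming a regular sequence in $\overline{\mathbb{F}}_q[x_1,\dots,x_k]$ and generating a radical ideal there, whose common zero locus in $\mathbb{P}^{k-1}(\overline{\mathbb{F}}_q)$ is exactly the set $X$ of (pairwise distinct) points, all of which lie in $\mathbb{P}^{k-1}(\mathbb{F}_q)$. Evaluation at the points of $X$: fix a representative $v_i\in\mathbb{F}_q^k\setminus\{0\}$ of each $P_i$; the code obtained by evaluating forms of degree $d$ at $X$ is the image of the map $f\mapsto(f(v_1),\dots,f(v_n))$ from the $\mathbb{F}_q$-vector space of homogeneous polynomials of degree $d$ in $\mathbb{F}_q[x_1,\dots,x_k]$ (together with $0$) to $\mathbb{F}_q^n$. A different choice of representatives rescales coordinates by nonzero scalars and does not change the minimum distance. *)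

(* Defs.v *)
From HB Require Import structures.
From mathcomp Require Export all_boot all_order all_algebra.
From mathcomp Require Export mpoly.

Set Implicit Arguments.
Unset Strict Implicit.
Unset Printing Implicit Defensive.

Import GRing.Theory.
Local Open Scope ring_scope.

(* Membership in the ideal (s_0, ..., s_(t-1)). *)
Definition ideal_gen (A : comNzRingType) (s : seq A) (p : A) : Prop :=
  exists a : nat -> A, p = \sum_(i < size s) a i * s`_i.

Definition regular_sequence (A : comNzRingType) (s : seq A) : Prop :=
  ~ ideal_gen s 1 /\
  forall (i : nat) (p : A), (i < size s)%N ->
    ideal_gen (take i s) (p * s`_i) -> ideal_gen (take i s) p.

Definition radical_ideal (A : comNzRingType) (I : A -> Prop) : Prop :=
  forall (p : A) (m : nat), I (p ^+ m) -> I p.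

(* L is algebraically closed by its type, so this says that iota exhibits L as
   an algebraic closure of F. *)
Definition algebraic_closure (F : fieldType) (L : closedFieldType)
    (iota : {rmorphism F -> L}) : Prop :=
  forall x : L, algebraicOver iota x.

Definition peval (k : nat) (R : comNzRingType) (p : {mpoly R[k]})
    (w : 'rV[R]_k) : R := p.@[fun j => w 0 j].

(* Nonzero vectors w1, w2 represent the same point of projective space. *)
Definition proj_eq (R : fieldType) (k : nat) (w1 w2 : 'rV[R]_k) : Prop :=
  exists2 c : R, c != 0 & w1 = c *: w2.

(* v lists representatives of pairwise distinct F-rational points of P^r; they
   are all the points over L of a reduced complete intersection of degrees
   ds that is defined over F.  With r equations in P^r, being a complete
   intersection entails being zero-dimensional; regularity excludes f_i = 0
   (which is d-homogeneous for every d), so f_i has degree exactly ds_i. *)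
Definition reduced_ci_points (F : fieldType) (L : closedFieldType)
    (iota : {rmorphism F -> L}) (r : nat) (ds : r.-tuple nat)
    (n : nat) (v : 'I_n -> 'rV[F]_r.+1) : Prop :=
  [/\ forall i, v i != 0,
      forall i j, proj_eq (v i) (v j) -> i = j
    & exists fs : r.-tuple {mpoly F[r.+1]},
      let gs := [seq map_mpoly iota f | f <- fs] in
      [/\ forall i : 'I_r, tnth fs i \is (tnth ds i).-homog,
          regular_sequence gs,
          radical_ideal (ideal_gen gs)
        & forall w : 'rV[L]_r.+1, w != 0 ->
            (forall g, g \in gs -> peval g w = 0) <->
            (exists i : 'I_n, proj_eq w (map_mx iota (v i)))]].

Section EvaluationCode.

Variables (F : fieldType) (r n d : nat) (v : 'I_n -> 'rV[F]_r.+1).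

Definition eval_forms (f : dhomog r.+1 F d) : 'rV[F]_n :=
  \row_i peval (mpoly_of_dhomog f) (v i).

Lemma eval_forms_is_linear : linear eval_forms.
Proof.
move=> a f g; apply/rowP=> i; rewrite !mxE /peval.
by rewrite (linearP (@mpoly_of_dhomog _ F d)) mevalD mevalZ.
Qed.

HB.instance Definition _ :=
  GRing.isLinear.Build F (dhomog r.+1 F d) 'rV[F]_n _ eval_forms
    eval_forms_is_linear.

Definition evaluation_code : {vspace 'rV[F]_n} := limg (linfun eval_forms).

End EvaluationCode.

Arguments evaluation_code {F r n} d v.

Definition hamming_weight (F : fieldType) (n : nat) (c : 'rV[F]_n) : nat :=
  #|[set i | c 0 i != 0]|.

(* vpick C is a nonzero word of C whenever C is not the zero code; the zero
   code, which has no nonzero word, gets the value 0. *)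
Definition min_distance (F : finFieldType) (n : nat)
    (C : {vspace 'rV[F]_n}) : nat :=
  hamming_weight
    [arg min_(c < vpick C | (c \in C) && (c != 0)%R) hamming_weight c]%N.

(* Main.v *)
From HB Require Import structures.
Require Import Defs.
From Stdlib Require Import Classical_Prop.
From mathcomp Require Import all_boot all_order all_algebra.
From mathcomp Require Import mpoly ring zify.

(** Write I for the ideal of the complete intersection, generated by f_1, ...,
f_r in S, the polynomial ring in r + 1 variables, and let F be a nonzero form
of degree d < d_1.  The forms that vanish at the points of X where F does not
vanish are the G with F G in I: this uses that I is radical and the
Nullstellensatz.  Hence the number of these points is at least the dimension of
the image of multiplication by F on S / I in a large degree t, and that
dimension is H(I, t) - H(I + F, t), where H is the Hilbert function of the
quotient.

If F, g_2, ..., g_r is a regular sequence of forms in I + F with deg g_i = d_i,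
then H(I + F, t) is at most H of the ideal (F, g_2, ..., g_r).  The Hilbert
function of r forms in regular sequence in r + 1 variables is eventually the
product of their degrees, so the number of points is at least
d_1 d_2 ... d_r - d d_2 ... d_r, which is the bound
([nonvanishing_ge_degrees]).

The g_i are found by exchange.  Choose a linear form l without zeros on X and
put g_i = f_i + t_i l^(d_i - d_1) f_1 with t_i transcendental over the previous
field; this leaves the ideal I unchanged because f_1 stays a generator.  That
g_i is a nonzerodivisor modulo F, g_2, ..., g_(i-1) follows from McCoy's
theorem on zero divisors in polynomial rings ([mccoy_linear]), once no nonzero
class is killed both by f_i and by l^(d_i - d_1) f_1 ([colon_pair]).  The
ground field therefore grows during the induction ([nonvanishing_bound]), which
is harmless: Hilbert functions and the description of I as a vanishing ideal
survive the extension.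

The induction permutes regular sequences and changes generators freely.  This
is legitimate because forms are a regular sequence exactly when the Hilbert
function of the ideal they generate has the expected value
([regular_hilbert_cons]), a condition that depends only on the ideal and on the
multiset of degrees.

The Nullstellensatz is needed only for ideals with bounded Hilbert function.
There a point is produced one coordinate at a time: boundedness gives a binary
form in x_i and x_j that is a zero divisor, and a linear factor of it fixes the
i-th coordinate ([torsion_point]). *)

Set Implicit Arguments.
Unset Strict Implicit.
Unset Printing Implicit Defensive.
Import Order.TTheory GRing.Theory Num.Theory.

Local Open Scope ring_scope.

(** * Ideals and nonzerodivisors *)

Section IdealMembership.
Variable A : comNzRingType.
Implicit Types (f p q : A) (fs gs : seq A).

Lemma ideal_gen_nil p : ideal_gen [::] p <-> p = 0.
Proof.
split=> [[a ->]|->]; first by rewrite big_ord0.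
by exists (fun=> 0); rewrite big_ord0.
Qed.

Lemma ideal_gen_cons f fs p :
  ideal_gen (f :: fs) p <-> exists a, ideal_gen fs (p - a * f).
Proof.
split=> [[a ->]|[a0 [a pE]]].
  by exists (a 0), (fun i => a i.+1); rewrite big_ord_recl /= addrC addKr.
exists (fun i => if i is j.+1 then a j else a0).
by rewrite big_ord_recl /= -pE addrC subrK.
Qed.

Lemma ideal_gen0 fs : ideal_gen fs 0.
Proof. by exists (fun=> 0); rewrite big1 // => i _; rewrite mul0r. Qed.

Lemma ideal_genD fs p q :
  ideal_gen fs p -> ideal_gen fs q -> ideal_gen fs (p + q).
Proof.
move=> [a ->] [b ->]; exists (fun i => a i + b i).
by rewrite -big_split; apply: eq_bigr => i _; rewrite mulrDl.
Qed.

Lemma ideal_genM fs a p : ideal_gen fs p -> ideal_gen fs (a * p).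
Proof.
move=> [b ->]; exists (fun i => a * b i).
by rewrite mulr_sumr; apply: eq_bigr => i _; rewrite mulrA.
Qed.

Lemma ideal_genN fs p : ideal_gen fs p -> ideal_gen fs (- p).
Proof. by move=> /(ideal_genM (-1)); rewrite mulN1r. Qed.

Lemma ideal_genB fs p q :
  ideal_gen fs p -> ideal_gen fs q -> ideal_gen fs (p - q).
Proof. by move=> hp hq; apply: ideal_genD hp (ideal_genN hq). Qed.

Lemma ideal_gen_sum fs (I : Type) (r : seq I) (P : pred I) (F : I -> A) :
  (forall i, P i -> ideal_gen fs (F i)) -> ideal_gen fs (\sum_(i <- r | P i) F i).
Proof.
by move=> hF; elim/big_ind: _ => //; [apply: ideal_gen0 | apply: ideal_genD].
Qed.

Lemma ideal_gen_mem fs f : f \in fs -> ideal_gen fs f.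
Proof.
elim: fs => // g fs IH; rewrite inE => /predU1P[->|/IH hf].
  by apply/ideal_gen_cons; exists 1; rewrite mul1r subrr; apply: ideal_gen0.
by apply/ideal_gen_cons; exists 0; rewrite mul0r subr0.
Qed.

Lemma ideal_gen_sub fs gs p :
    (forall f, f \in fs -> ideal_gen gs f) ->
  ideal_gen fs p -> ideal_gen gs p.
Proof.
move=> fs_gs [a ->]; apply: ideal_gen_sum => i _.
by apply/ideal_genM/fs_gs/mem_nth.
Qed.

Lemma ideal_gen_subset fs gs p :
  {subset fs <= gs} -> ideal_gen fs p -> ideal_gen gs p.
Proof. by move=> s_fg; apply: ideal_gen_sub => f /s_fg/ideal_gen_mem. Qed.

Lemma ideal_gen_consW f fs p : ideal_gen fs p -> ideal_gen (f :: fs) p.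
Proof. by apply: ideal_gen_subset => g; rewrite inE orbC => ->. Qed.

Definition nonzerodivisor f fs : Prop :=
  forall p, ideal_gen fs (p * f) -> ideal_gen fs p.

Lemma nonzerodivisorM f g fs :
  nonzerodivisor f fs -> nonzerodivisor g fs -> nonzerodivisor (f * g) fs.
Proof. by move=> nzf nzg p; rewrite mulrA => /nzg/nzf. Qed.

Lemma nonzerodivisorX f e fs : nonzerodivisor f fs -> nonzerodivisor (f ^+ e) fs.
Proof.
move=> nzf; elim: e => [|e IH]; first by move=> p; rewrite mulr1.
by rewrite exprS; apply: nonzerodivisorM.
Qed.

(** If u c = x g and u f = y g modulo fs, cancelling g gives x f = y c, so f
divides y modulo fs, and cancelling f in u f = y g shows that g divides u. In
other words, replacing one of two regular elements by g leaves depth at least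
one for the pair (c, f). *)
Lemma colon_pair g f c fs :
    nonzerodivisor g fs -> nonzerodivisor f fs -> nonzerodivisor c (f :: fs) ->
  forall u, ideal_gen (g :: fs) (u * c) -> ideal_gen (g :: fs) (u * f) ->
  ideal_gen (g :: fs) u.
Proof.
move=> nzg nzf nzc u /ideal_gen_cons[x ucx] /ideal_gen_cons[y ufy].
have: ideal_gen fs ((x * f - y * c) * g).
  have ->: (x * f - y * c) * g = c * (u * f - y * g) - f * (u * c - x * g).
    by ring.
  by apply: ideal_genB; apply: ideal_genM.
move=> /nzg hxy.
have /nzc : ideal_gen (f :: fs) (y * c).
  apply/ideal_gen_cons; exists x.
  by rewrite -opprB; apply: ideal_genN.
move=> /ideal_gen_cons[z hz]; apply/ideal_gen_cons; exists z.
apply: nzf; have ->: (u - z * g) * f = (u * f - y * g) + g * (y - z * f) by ring.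
by apply: ideal_genD => //; apply: ideal_genM.
Qed.

(** McCoy's theorem for the linear polynomial f + c t over the quotient by fs:
the p i are the coefficients of a polynomial in t that it annihilates. The top
coefficient is killed by c, so multiplication by c lowers the degree, and by
induction c kills every coefficient; then so does f. *)
Lemma mccoy_linear f c fs :
    (forall u, ideal_gen fs (u * c) -> ideal_gen fs (u * f) -> ideal_gen fs u) ->
  forall (n : nat) (p : nat -> A),
    (forall i, (n <= i)%N -> ideal_gen fs (p i)) ->
    ideal_gen fs (p 0 * f) ->
    (forall i, ideal_gen fs (p i.+1 * f + p i * c)) ->
  forall i, ideal_gen fs (p i).
Proof.
move=> depth; elim=> [|n IH] p p_ge p0 pS i; first exact: p_ge.
have hc j : ideal_gen fs (p j * c).
  apply: (IH (fun k => p k * c)) => [k||] /=.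
  - rewrite leq_eqVlt => /predU1P[<-|nk].
      have := ideal_genB (pS n) (ideal_genM f (p_ge n.+1 (leqnn _))).
      by rewrite mulrC [X in X - _]addrC addrK.
    by rewrite mulrC; apply/ideal_genM/p_ge.
  - by rewrite mulrAC mulrC; apply: ideal_genM.
  - move=> k; have ->: p k.+1 * c * f + p k * c * c = c * (p k.+1 * f + p k * c).
      by ring.
    exact: ideal_genM.
apply: depth => //; case: i => [|i] //.
by rewrite -[X in ideal_gen _ X](addrK (p i * c)); apply: ideal_genB.
Qed.

End IdealMembership.

(** * Homogeneous ideals *)

Section HomogeneousIdeals.
Variables (m : nat) (K : comNzRingType).
Local Notation S := {mpoly K[m]}.
Implicit Types (f p q : S) (x : nat * S) (xs ys : seq (nat * S)).

(** A form is paired with its degree, which the zero polynomial does not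
determine. *)
Definition positive_form x := (0 < x.1)%N && (x.2 \is x.1.-homog).

Lemma pihomogM d f s p : f \is d.-homog ->
  pihomog mdeg s (p * f) =
  if (d <= s)%N then pihomog mdeg (s - d) p * f else 0.
Proof.
move=> hf; have comp e : pihomog mdeg s (pihomog mdeg e p * f) =
    if (e + d == s)%N then pihomog mdeg e p * f else 0.
  have hpf : pihomog mdeg e p * f \is (e + d).-homog.
    by apply: dhomogM => //; apply: pihomogP.
  case: eqP => [<-|/eqP ne]; first exact: pihomog_dE.
  exact: pihomog_ne0 ne hpf.
have szp : (msize p <= maxn (msize p) s.+1)%N by apply: leq_maxl.
rewrite {1}[p](pihomog_partitionE szp) mulr_suml raddf_sum /=.
under eq_bigr do rewrite comp.
case: leqP => ds.
  have lt : (s - d < maxn (msize p) s.+1)%N by lia.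
  rewrite (bigD1 (Ordinal lt)) //= subnK // eqxx big1 ?addr0 // => i.
  by rewrite -val_eqE /= => ne; case: eqP => // E; lia.
by rewrite big1 // => i _; case: eqP => // E; lia.
Qed.

Lemma ideal_gen_pihomog xs s p : all positive_form xs ->
  ideal_gen (unzip2 xs) p -> ideal_gen (unzip2 xs) (pihomog mdeg s p).
Proof.
elim: xs p => [|x xs IH] p /=.
  by move=> _ /ideal_gen_nil ->; rewrite raddf0; apply: ideal_gen0.
move=> /andP[/andP[_ hx] hxs] /ideal_gen_cons[a /(IH _ hxs)].
rewrite raddfB /= (pihomogM _ _ hx); case: ifP => _ h; apply/ideal_gen_cons.
  by exists (pihomog mdeg (s - x.1) a).
by exists 0; rewrite mul0r.
Qed.

(** Every generator has degree above e, so does every term of a combination. *)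
Lemma ideal_gen_low_degree xs e q :
    all positive_form xs -> all (fun x => e < x.1)%N xs ->
  ideal_gen (unzip2 xs) q -> pihomog mdeg e q = 0.
Proof.
elim: xs q => [|x xs IH] q /=; first by move=> _ _ /ideal_gen_nil ->; rewrite raddf0.
move=> /andP[/andP[_ hx] hxs] /andP[ex exs] /ideal_gen_cons[a /(IH _ hxs exs)].
by rewrite raddfB /= (pihomogM _ _ hx) leqNgt ex subr0.
Qed.

(** A homogeneous ideal contains the components of its members, so it is enough
to cancel the form from one component at a time. *)
Lemma homog_nonzerodivisor x xs : positive_form x -> all positive_form xs ->
  (forall s p, p \is s.-homog -> ideal_gen (unzip2 xs) (p * x.2) ->
     ideal_gen (unzip2 xs) p) ->
  nonzerodivisor x.2 (unzip2 xs).
Proof.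
move=> /andP[_ hx] hxs hom p hp.
rewrite [p](pihomog_partitionE (leqnn (msize p))).
apply: ideal_gen_sum => i _; apply: (hom i); first exact: pihomogP.
have := ideal_gen_pihomog (i + x.1) hxs hp.
by rewrite (pihomogM _ _ hx) leq_addl addnK.
Qed.

End HomogeneousIdeals.

Arguments positive_form {m K} x.

(** * Finite differences and Hilbert functions *)

Section BackwardDifferences.
Implicit Types (h : nat -> int) (ds : seq nat).

(** On generating series this is multiplication by 1 - t^d, a function on the
natural numbers being extended by 0. *)
Definition diff d h s : int := h s - (if (d <= s)%N then h (s - d)%N else 0).

Definition diffs ds h := foldr diff h ds.

Lemma eq_diff d h h' : h =1 h' -> diff d h =1 diff d h'.
Proof. by move=> eq_h s; rewrite /diff !eq_h. Qed.

Lemma eq_diffs ds h h' : h =1 h' -> diffs ds h =1 diffs ds h'.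
Proof. by move=> eq_h; elim: ds => //= d ds IH; exact: (eq_diff d IH). Qed.

Lemma diffC d e h : diff d (diff e h) =1 diff e (diff d h).
Proof.
move=> s; rewrite /diff.
have -> : (s - d - e = s - e - d)%N by lia.
by do ?[case: ifP => ?]; lia.
Qed.

Lemma diffs_diff ds d h : diffs ds (diff d h) =1 diff d (diffs ds h).
Proof.
elim: ds => //= e ds IH s; rewrite (eq_diff _ IH) diffC.
by [].
Qed.

Lemma diffs_cat ds es h : diffs (ds ++ es) h = diffs ds (diffs es h).
Proof. by rewrite /diffs foldr_cat. Qed.

(** The factors 1 - t^d of the generating series commute. *)
Lemma diffs_perm ds es h : perm_eq ds es -> diffs ds h =1 diffs es h.
Proof.
elim: ds es => [|d ds IH] es; first by rewrite perm_sym => /perm_nilP ->.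
move=> pde; have des : d \in es by rewrite -(perm_mem pde) mem_head.
(* Move d to the front of the second list. *)
case/splitPr: des pde => u w pde s.
have {}pde : perm_eq ds (u ++ w) by rewrite -(perm_cons d) (permPl pde) -cat1s perm_catCA.
rewrite /= (eq_diff _ (IH _ pde)) !diffs_cat /= diffs_diff.
by [].
Qed.

(** The Hilbert function of the polynomial ring in n + 1 variables. *)
Definition binomial_poly n s : int := 'C(s + n, n)%:Z.

Lemma diff1_binomial n : diff 1 (binomial_poly n.+1) =1 binomial_poly n.
Proof.
case=> [|s]; rewrite /diff /binomial_poly /= ?add0n ?binn //.
by rewrite subn1 /= addSn binS addSnnS; lia.
Qed.

(** Since 1 - t^d = (1 - t) (1 + ... + t^(d - 1)), each difference of step d
lowers the polynomial degree by one and multiplies the leading behaviour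
by d. *)
Lemma diffs_binomial_eventually ds :
  exists N, forall s, (N <= s)%N ->
    diffs ds (binomial_poly (size ds)) s = (\prod_(d <- ds) d)%N%:Z.
Proof.
elim: ds => [|d ds [N IH]].
  by exists 0%N => s _; rewrite big_nil /= /binomial_poly bin0.
exists (N + d)%N => s Ns; set G := diffs ds (binomial_poly (size ds).+1).
have GS t : (N <= t)%N -> G t.+1 = G t + (\prod_(e <- ds) e)%N%:Z.
  move=> Nt; rewrite -(IH t.+1) 1?leqW // -(eq_diffs _ (diff1_binomial _)).
  by rewrite diffs_diff -/G /diff subn1 /= addrC subrK.
have GD e t : (N <= t)%N -> G (t + e)%N = G t + (e * \prod_(e <- ds) e)%N%:Z.
  move=> Nt; elim: e => [|e IHe]; first by rewrite addn0 mul0n addr0.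
  by rewrite addnS GS ?IHe ?(leq_trans Nt) ?leq_addr // mulSn; lia.
rewrite big_cons /= -/G /diff; have ds' : (d <= s)%N by lia.
by rewrite ds' -{1}(subnK ds') GD; lia.
Qed.

End BackwardDifferences.

Section HilbertFunctions.
Variables (K : fieldType) (n : nat).
Local Notation S := {mpoly K[n.+1]}.
Local Notation Sd s := (dhomog n.+1 K s).
Implicit Types (p q : S) (x y : nat * S) (xs ys : seq (nat * S)) (s : nat).

Definition homog_part s p : Sd s := DHomog (pihomogP mdeg s p).

Lemma homog_partE s p : p \is s.-homog -> homog_part s p = p :> S.
Proof. exact: pihomog_dE. Qed.

(** When s < x.1 the source is the space of constants, because the subtraction is
truncated; for a form x the projection to degree s then makes the map zero, as
it should be since multiples of x have degree at least x.1. *)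
Definition mul_form x s (q : Sd (s - x.1)) : Sd s :=
  homog_part s (mpoly_of_dhomog q * x.2).

Lemma mul_form_is_linear x s : linear (@mul_form x s).
Proof.
move=> a p q; apply: val_inj => /=.
by rewrite mulrDl -scalerAl linearP.
Qed.

HB.instance Definition _ x s :=
  GRing.isLinear.Build K (Sd (s - x.1)) (Sd s) _ (@mul_form x s)
    (@mul_form_is_linear x s).

Lemma mul_formE x s (q : Sd (s - x.1)) : positive_form x ->
  mul_form q = (if (x.1 <= s)%N then mpoly_of_dhomog q * x.2 else 0) :> S.
Proof.
move=> /andP[_ hx]; rewrite /= (pihomogM _ _ hx); case: ifP => // _.
by rewrite pihomog_dE //; case: (q).
Qed.

Fixpoint ideal_part xs s : {vspace Sd s} :=
  if xs is x :: xs' then (limg (linfun (@mul_form x s)) + ideal_part xs' s)%VS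
  else 0%VS.

(** A homogeneous member of the ideal is a combination with homogeneous
coefficients: project an arbitrary combination to its degree. *)
Lemma ideal_partP xs s (u : Sd s) : all positive_form xs ->
  (u \in ideal_part xs s) <-> ideal_gen (unzip2 xs) (mpoly_of_dhomog u).
Proof.
elim: xs u => [|x xs IH] u /=.
  move=> _; rewrite memv0 ideal_gen_nil; split=> [/eqP -> //|u0].
  exact/eqP/val_inj.
move=> /andP[hx hxs]; split.
  case/memv_addP => _ /memv_imgP[q _ ->] [w /(IH w hxs) hw ->].
  rewrite lfunE raddfD /=; have /= -> := mul_formE q hx.
  apply/ideal_gen_cons.
  case: ifP => _; last by exists 0; rewrite mul0r subr0 add0r.
  by exists (mpoly_of_dhomog q); rewrite addrC addKr.
case/ideal_gen_cons=> a /(ideal_gen_pihomog s hxs).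
have [_ hxd] := andP hx.
rewrite raddfB /= (pihomogM _ _ hxd) pihomog_dE; last by case: (u).
move=> hu; pose q := homog_part (s - x.1) a.
rewrite -[u](subrK (mul_form q)) addrC; apply: memv_add.
  by rewrite -[mul_form q](lfunE (@mul_form x s)); apply: memv_img; apply: memvf.
apply/(IH _ hxs); rewrite raddfB /= -/(mul_form q).
by have /= -> := mul_formE q hx.
Qed.

Lemma eq_ideal_part xs ys s : all positive_form xs -> all positive_form ys ->
  (forall p, ideal_gen (unzip2 xs) p <-> ideal_gen (unzip2 ys) p) ->
  ideal_part xs s = ideal_part ys s.
Proof.
move=> hxs hys eqI; apply/vspaceP => u.
by apply/idP/idP => /ideal_partP h; apply/ideal_partP => //; apply/eqI/h.
Qed.

Definition hilbert xs s : int :=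
  (\dim {:Sd s})%:Z - (\dim (ideal_part xs s))%:Z.

Lemma hilbert_nil : hilbert [::] =1 binomial_poly n.
Proof.
move=> s; rewrite /hilbert /= dimv0 subr0 dimvf /binomial_poly.
by rewrite -[X in 'C(_, X)](addKn s) bin_sub ?leq_addr.
Qed.

(** Rank-nullity for multiplication by x from degree s - x.1 to the quotient in
degree s. The last difference is the dimension of its kernel on the
quotient. *)
Lemma hilbert_cons x xs s :
  hilbert (x :: xs) s =
  hilbert xs s - hilbert xs (s - x.1) +
  ((\dim (linfun (@mul_form x s) @^-1: ideal_part xs s))%:Z -
   (\dim (ideal_part xs (s - x.1)))%:Z).
Proof.
rewrite /hilbert /=; set V := ideal_part xs s; set f := linfun _.
have := dimv_sum_cap (limg f) V.
have := limg_ker_dim f fullv; rewrite capfv.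
have := limg_ker_dim f (f @^-1: V).
rewrite -{2}lpreim_cap_limg lpreimK ?capvSr //.
have ->: (f @^-1: V :&: lker f = lker f)%VS.
  by apply/capv_idPr; rewrite -lpreim0 lpreimS ?sub0v.
rewrite [(limg f :&: V)%VS]capvC => h1 h2 h3; rewrite -h1 -h2.
move/(congr1 Posz): h3; rewrite !PoszD => /(canRL (addrK _)) ->.
by ring.
Qed.

Lemma hilbert_cons_small x xs s : positive_form x -> (s < x.1)%N ->
  hilbert (x :: xs) s = hilbert xs s.
Proof.
move=> hx sx; rewrite /hilbert /=; congr (_ - (\dim _)%:Z).
suff -> : linfun (@mul_form x s) = 0 by rewrite lim0g add0v.
apply/lfunP => q; apply: val_inj; rewrite !lfunE /= -/(mul_form q).
by have /= -> := mul_formE q hx; rewrite leqNgt sx.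
Qed.

Lemma sub_preim_mul_form x xs s : positive_form x -> all positive_form xs ->
    (x.1 <= s)%N ->
  (ideal_part xs (s - x.1) <= linfun (@mul_form x s) @^-1: ideal_part xs s)%VS.
Proof.
move=> hx hxs xs_s; apply/subvP => q /(ideal_partP _ hxs) hq.
rewrite -memv_preim lfunE /=; apply/(ideal_partP _ hxs).
by rewrite mul_formE // xs_s mulrC; apply: ideal_genM.
Qed.

(** Multiplication by a form on the quotient can only have a kernel, which makes
the next quotient larger than in the regular case. *)
Lemma diff_hilbert_le x xs s : positive_form x -> all positive_form xs ->
  diff x.1 (hilbert xs) s <= hilbert (x :: xs) s.
Proof.
move=> hx hxs; rewrite /diff; case: leqP => [le|lt]; last first.
  by rewrite hilbert_cons_small // subr0.
have /dimvS := sub_preim_mul_form hx hxs le.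
by rewrite hilbert_cons lerDl subr_ge0 lez_nat.
Qed.

(** The defect in [diff_hilbert_le] is the kernel of multiplication by the form,
so equality in all degrees says that this kernel is zero. *)
Lemma diff_hilbertP x xs : positive_form x -> all positive_form xs ->
  hilbert (x :: xs) =1 diff x.1 (hilbert xs) <->
  nonzerodivisor x.2 (unzip2 xs).
Proof.
move=> hx hxs; split=> [eqh|nzx s].
  apply: homog_nonzerodivisor => // s p hp hpx.
  have le := leq_addl s x.1; move: hp; rewrite -{1}[s](addnK x.1).
  move: (s + x.1)%N le => t le hp.
  have sub := sub_preim_mul_form hx hxs le.
  have /eqP eqV : ideal_part xs (t - x.1) ==
                  (linfun (@mul_form x t) @^-1: ideal_part xs t)%VS.
    rewrite -(geq_leqif (dimv_leqif_eq sub)).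
    have /eqP := eqh t; rewrite hilbert_cons /diff le -subr_eq0 [X in X == 0]addrC.
    by rewrite addKr subr_eq0 eqz_nat eq_sym => /eqP ->.
  rewrite -(homog_partE hp); apply/(ideal_partP _ hxs).
  rewrite eqV -memv_preim lfunE /=; apply/(ideal_partP _ hxs).
  by rewrite mul_formE // le homog_partE.
rewrite /diff; case: leqP => [le|lt]; last first.
  by rewrite hilbert_cons_small // subr0.
suff eqV : (linfun (@mul_form x s) @^-1: ideal_part xs s)%VS = ideal_part xs (s - x.1).
  by rewrite hilbert_cons eqV subrr addr0.
apply/eqP; rewrite eqEsubv sub_preim_mul_form // andbT.
apply/subvP => q; rewrite -memv_preim lfunE /= => /(ideal_partP _ hxs).
rewrite mul_formE // le => /nzx hq; exact/(ideal_partP _ hxs).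
Qed.

End HilbertFunctions.

(** * Regular sequences through Hilbert functions *)

Section RegularHilbertFunctions.
Variables (K : fieldType) (n : nat).
Local Notation S := {mpoly K[n.+1]}.
Implicit Types (x y : nat * S) (xs ys : seq (nat * S)).

(** The Hilbert function that the quotient has when the forms are a regular
sequence. The condition involves only the ideal and the multiset of degrees,
hence neither the order of the forms nor a change of generators matters. *)
Definition regular_hilbert xs : Prop :=
  hilbert xs =1 diffs (unzip1 xs) (binomial_poly n).

Lemma regular_hilbert_nil : regular_hilbert [::].
Proof. exact: hilbert_nil. Qed.

(** If the prefix deviated first in degree s, it would deviate upwards, and the
remaining form, having positive degree, could not compensate this in
degree s. *)
Lemma hilbert_prefix_lex x xs N :
    positive_form x -> all positive_form xs ->
    (forall M, (forall s, (s < M)%N ->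
         hilbert xs s = diffs (unzip1 xs) (binomial_poly n) s) ->
       diffs (unzip1 xs) (binomial_poly n) M <= hilbert xs M) ->
    (forall s, (s < N)%N -> hilbert (x :: xs) s =
       diffs (unzip1 (x :: xs)) (binomial_poly n) s) ->
  forall s, (s < N)%N ->
    hilbert xs s = diffs (unzip1 xs) (binomial_poly n) s.
Proof.
move=> hx hxs hge eqN s; elim/ltn_ind: s => s IH sN.
have below t : (t < s)%N -> hilbert xs t = diffs (unzip1 xs) (binomial_poly n) t.
  by move=> ts; apply: IH (ltn_trans ts sN).
apply/eqP; rewrite eq_le hge // andbT.
have := diff_hilbert_le s hx hxs; rewrite eqN //= /diff.
case: ifP => // xs_s; last by rewrite !subr0.
rewrite (below (s - x.1)%N) ?lerD2r //.
by case/andP: hx => x_gt0 _; rewrite ltn_subrL x_gt0 (leq_trans x_gt0).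
Qed.

(** Among forms of given degrees the regular Hilbert function is the smallest in
the lexicographic order: at the first degree of disagreement the actual value is
the larger one. *)
Lemma hilbert_lex xs N : all positive_form xs ->
    (forall s, (s < N)%N -> hilbert xs s =
       diffs (unzip1 xs) (binomial_poly n) s) ->
  diffs (unzip1 xs) (binomial_poly n) N <= hilbert xs N.
Proof.
elim: xs N => [|x xs IH] N /=; first by rewrite hilbert_nil.
case/andP=> hx hxs eqN.
have below := hilbert_prefix_lex hx hxs (fun M => IH M hxs) eqN.
apply: le_trans (diff_hilbert_le N hx hxs); rewrite /diff.
case: ifP => xN; last by rewrite !subr0 IH.
rewrite (below (N - x.1)%N) ?lerD2r; first exact: IH.
by case/andP: hx => x_gt0 _; rewrite ltn_subrL x_gt0 (leq_trans x_gt0).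
Qed.

(** Lexicographic minimality forces the Hilbert function of the tail to be the
regular one, after which the first form accounts for the whole difference and
is a nonzerodivisor. *)
Lemma regular_hilbert_cons x xs : positive_form x -> all positive_form xs ->
  regular_hilbert (x :: xs) <->
  regular_hilbert xs /\ nonzerodivisor x.2 (unzip2 xs).
Proof.
move=> hx hxs; split=> [reg|[reg nzx] s]; last first.
  by rewrite (diff_hilbertP hx hxs).2 //; apply: eq_diff.
have reg' : regular_hilbert xs.
  move=> s; apply: (hilbert_prefix_lex (N := s.+1) hx hxs) => // M.
  exact: hilbert_lex.
split=> //; apply/diff_hilbertP => // s.
by rewrite reg /=; apply/esym; apply: eq_diff.
Qed.

Lemma regular_hilbert_catr xs ys : all positive_form (xs ++ ys) ->
  regular_hilbert (xs ++ ys) -> regular_hilbert ys.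
Proof.
elim: xs => //= x xs IH /andP[hx hxs] /(regular_hilbert_cons hx hxs)[reg _].
exact: IH.
Qed.

Lemma eq_regular_hilbert xs ys :
    all positive_form xs -> all positive_form ys ->
    perm_eq (unzip1 xs) (unzip1 ys) ->
    (forall p, ideal_gen (unzip2 xs) p <-> ideal_gen (unzip2 ys) p) ->
  regular_hilbert xs -> regular_hilbert ys.
Proof.
move=> hxs hys pxy eqI reg s.
by rewrite -(diffs_perm _ pxy) -reg /hilbert (eq_ideal_part s hxs hys eqI).
Qed.

Lemma regular_hilbert_perm xs ys : all positive_form xs -> perm_eq xs ys ->
  regular_hilbert xs -> regular_hilbert ys.
Proof.
move=> hxs pxy; have hys : all positive_form ys by rewrite -(perm_all _ pxy).
apply: eq_regular_hilbert => //; first exact: perm_map.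
have eqm : unzip2 xs =i unzip2 ys by apply: perm_mem; apply: perm_map.
by move=> p; split; apply: ideal_gen_subset => f; rewrite eqm.
Qed.

Lemma regular_sequence_hilbert xs : all positive_form xs ->
  regular_sequence (unzip2 xs) -> regular_hilbert xs.
Proof.
move=> hxs [_ reg].
suff: forall i, (i <= size xs)%N -> regular_hilbert (take i xs).
  by move/(_ _ (leqnn _)); rewrite take_size.
elim=> [|i IH] lti; first by rewrite take0; apply: regular_hilbert_nil.
have hi : all positive_form (take i xs).
  by apply/allP => y /mem_take; apply/allP.
have hx : positive_form (nth (0%N, 0) xs i) by apply: (all_nthP _ hxs).
rewrite (take_nth (0%N, 0)) //.
apply: (@regular_hilbert_perm (nth (0%N, 0) xs i :: take i xs)).
- by rewrite /= hx.
- by rewrite perm_sym perm_rcons.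
apply/regular_hilbert_cons => //; split; first exact/IH/ltnW.
rewrite /unzip2 map_take => p hp; apply: reg; first by rewrite size_map.
by rewrite (nth_map (0%N, 0)).
Qed.

(** In n + 1 variables, n forms in regular sequence define a scheme of dimension
zero, whose degree is the product of the degrees of the forms. *)
Lemma regular_hilbert_eventually xs : size xs = n -> regular_hilbert xs ->
  exists N, forall s, (N <= s)%N -> hilbert xs s = (\prod_(d <- unzip1 xs) d)%N%:Z.
Proof.
move=> szn reg; have [N hN] := diffs_binomial_eventually (unzip1 xs).
by exists N => s Ns; rewrite reg -(hN s Ns) size_map szn.
Qed.

End RegularHilbertFunctions.

(** * Adjoining a transcendental *)

(** The representative of a fraction provides its denominator. *)
Lemma fraction_denominator (R : idomainType) (x : {fraction R}) :
  exists2 d : R, d != 0 & exists c : R, FracField.tofrac d * x = FracField.tofrac c.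
Proof.
elim/quotW: x => x; exists (frac x).2; first exact: denom_ratioP.
exists (frac x).1; unlock FracField.tofrac; rewrite -[LHS]FracField.pi_mul.
apply/eqmodP; rewrite /= FracField.equivfE /FracField.mulf.
by rewrite !numden_Ratio ?(oner_eq0, mul1r, mulr1) // denom_ratioP.
Qed.

Lemma meval_map (R1 R2 : comNzRingType) (f : {rmorphism R1 -> R2}) (m : nat)
    (p : {mpoly R1[m]}) (w : 'I_m -> R1) :
  (map_mpoly f p).@[f \o w] = f p.@[w].
Proof.
elim/mpolyind: p => [|c mm p _ _ IH]; first by rewrite !raddf0.
rewrite !raddfD /= IH map_mpolyZ map_mpolyX !mevalZ !mevalX rmorphM rmorph_prod.
by congr (_ * _ + _); apply: eq_bigr => i _; rewrite rmorphXn.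
Qed.

Section TranscendentalExtension.
Variables (K K' : fieldType) (m : nat) (frac : {rmorphism {poly K} -> K'}).
Hypothesis frac_inj : injective frac.
Hypothesis frac_denominator :
  forall x, exists2 d, d != 0 & exists c, frac d * x = frac c.

Local Notation A := {poly K}.
Local Notation S := {mpoly K[m]}.
Local Notation S' := {mpoly K'[m]}.
Local Notation St := {mpoly A[m]}.
Implicit Types (p f c : S) (q : St) (P : S') (fs : seq S) (i : nat).

Definition const_frac : {rmorphism K -> K'} := frac \o (@polyC K).

Definition ext : {rmorphism S -> S'} := map_mpoly const_frac.
(** Polynomials with coefficients in K[t], seen over the larger field K'. *)
Definition to_frac : {rmorphism St -> S'} := map_mpoly frac.
Definition to_poly : {rmorphism S -> St} := map_mpoly (@polyC K).
(** The coefficient of t^i, for the transcendental t adjoined to K. *)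
Definition tcoef i : {additive St -> S} := map_mpoly (@coefp K i).

Lemma extE p : ext p = to_frac (to_poly p).
Proof. by apply/mpolyP => mm; rewrite !mcoeff_map_mpoly. Qed.

Lemma to_frac_inj : injective to_frac.
Proof.
move=> q1 q2 /mpolyP eqq; apply/mpolyP => mm; have := eqq mm.
by rewrite !mcoeff_map_mpoly => /frac_inj.
Qed.

Lemma mcoeff_tcoef i q mm : (tcoef i q)@_mm = (q@_mm)`_i.
Proof. by rewrite mcoeff_map_mpoly. Qed.

Lemma tcoefM i q1 q2 :
  tcoef i (q1 * q2) = \sum_(j < i.+1) tcoef j q1 * tcoef (i - j) q2.
Proof.
apply/mpolyP => mm; rewrite mcoeff_tcoef mcoeffM coef_sum raddf_sum /=.
under eq_bigr do rewrite coefM.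
rewrite exchange_big; apply: eq_bigr => j _; rewrite mcoeffM.
by apply: eq_bigr => k _; rewrite !mcoeff_tcoef.
Qed.

Lemma tcoef_to_poly i p : tcoef i (to_poly p) = if i == 0%N then p else 0.
Proof.
apply/mpolyP => mm; rewrite mcoeff_tcoef mcoeff_map_mpoly coefC.
by case: ifP; rewrite ?mcoeff0.
Qed.

Lemma tcoefC i (D : A) : tcoef i D%:MP = (D`_i)%:MP.
Proof. exact: map_mpolyC. Qed.

Lemma tcoefM_to_poly i q f : tcoef i (q * to_poly f) = tcoef i q * f.
Proof.
rewrite tcoefM big_ord_recr /= subnn tcoef_to_poly eqxx big1 ?add0r // => j _.
by rewrite tcoef_to_poly subn_eq0 leqNgt ltn_ord mulr0.
Qed.

Lemma tcoefMX i q : tcoef i ('X%:MP * q) = if i is j.+1 then tcoef j q else 0.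
Proof.
apply/mpolyP => mm; rewrite mcoeff_tcoef mcoeffCM coefXM.
by case: i => [|i]; rewrite ?mcoeff0 // mcoeff_tcoef.
Qed.

Lemma tcoef_bound q : exists N, forall i, (N <= i)%N -> tcoef i q = 0.
Proof.
exists (\max_(mm <- msupp q) size q@_mm)%N => i Ni; apply/mpolyP => mm.
rewrite mcoeff_tcoef mcoeff0; have [mq|/memN_msupp_eq0 ->] := boolP (mm \in msupp q).
  by apply/nth_default/(leq_trans _ Ni)/leq_bigmax_seq.
by rewrite coef0.
Qed.

Lemma tcoef_expand q N : (forall i, (N <= i)%N -> tcoef i q = 0) ->
  q = \sum_(i < N) ('X^i)%:MP * to_poly (tcoef i q).
Proof.
move=> hN; apply/mpolyP => mm; apply/polyP => i; rewrite -!mcoeff_tcoef.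
congr (_@__); rewrite raddf_sum /=.
have term (j : 'I_N) : tcoef i (('X^j)%:MP * to_poly (tcoef j q)) =
    if i == j then tcoef j q else 0.
  rewrite tcoefM_to_poly tcoefC coefXn; case: eqP; rewrite ?mul0r // => _.
  by rewrite mul1r.
rewrite (eq_bigr _ (fun j _ => term j)); case: (ltnP i N) => [lt|Ni].
  rewrite (bigD1 (Ordinal lt)) //= eqxx big1 ?addr0 // => j.
  by rewrite -val_eqE eq_sym /= => /negbTE ->.
rewrite hN // big1 // => j _; case: eqP => // ij.
by have := ltn_ord j; rewrite -ij ltnNge Ni.
Qed.

Lemma to_fracC (D : A) : to_frac D%:MP = (frac D)%:MP.
Proof. exact: map_mpolyC. Qed.

Lemma clear_denominators P :
  exists2 D : A, D != 0 & exists q, to_frac D%:MP * P = to_frac q.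
Proof.
elim/mpolyind: P => [|c mm P _ _ [D D0 [q hq]]].
  by exists 1; rewrite ?oner_neq0 //; exists 0; rewrite mulr0 raddf0.
have [d d0 [b hb]] := frac_denominator c.
exists (D * d); first by rewrite mulf_neq0.
exists ((D * b)%:MP * 'X_[mm] + d%:MP * q).
have tX : to_frac 'X_[mm] = 'X_[mm] :> S' by rewrite /= map_mpolyX.
have tb : to_frac b%:MP = to_frac d%:MP * c%:MP by rewrite !to_fracC -hb mpolyCM.
rewrite mpolyCM (rmorphM to_frac) (rmorphD to_frac) (rmorphM to_frac).
rewrite mpolyCM (rmorphM to_frac D%:MP) tX tb (rmorphM to_frac _ q) -hq -mul_mpolyC.
move: (to_frac D%:MP) (to_frac d%:MP) => u v.
rewrite mulrDr; congr (_ + _); first by rewrite !mulrA.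
by rewrite mulrCA mulrA.
Qed.

Definition tcoefs_in fs q := forall i, ideal_gen fs (tcoef i q).

Lemma tcoefs_inM fs q1 q2 : tcoefs_in fs q2 -> tcoefs_in fs (q1 * q2).
Proof.
move=> h i; rewrite tcoefM; apply: ideal_gen_sum => j _.
exact: ideal_genM.
Qed.

Lemma tcoefs_in_to_frac fs q :
  tcoefs_in fs q -> ideal_gen (map ext fs) (to_frac q).
Proof.
move=> h; have [N /tcoef_expand ->] := tcoef_bound q.
rewrite raddf_sum; apply: ideal_gen_sum => i _.
rewrite /= rmorphM; apply: ideal_genM; rewrite -extE.
have [a ->] := h i; exists (fun j => ext (a j)).
rewrite raddf_sum size_map; apply: eq_bigr => j _.
by rewrite (nth_map 0) //= rmorphM.
Qed.

Lemma ideal_ext_denominator fs P : ideal_gen (map ext fs) P ->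
  exists2 D : A, D != 0 &
  exists2 q, tcoefs_in fs q & to_frac D%:MP * P = to_frac q.
Proof.
elim: fs P => [|f fs IH] P /=.
  move=> /ideal_gen_nil ->; exists 1; rewrite ?oner_neq0 //.
  by exists 0; rewrite ?mulr0 ?raddf0 // => i; rewrite raddf0; apply: ideal_gen0.
move=> /ideal_gen_cons[a /IH[D D0 [q hq DP]]].
have [E E0 [b Eb]] := clear_denominators a.
exists (D * E); first by rewrite mulf_neq0.
exists (D%:MP * b * to_poly f + E%:MP * q).
  move=> i; rewrite raddfD /=; apply: ideal_genD; last first.
    by apply: (tcoefs_inM (fs := f :: fs)) => j; apply: ideal_gen_consW.
  rewrite tcoefM_to_poly; apply: ideal_genM.
  by apply: ideal_gen_mem; rewrite mem_head.
rewrite rmorphD mpolyCM !rmorphM -Eb -DP -extE; ring.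
Qed.

(** Compare coefficients of t at the lowest power occurring in D: its coefficient
there is a nonzero scalar, and all the other terms involve earlier
coefficients of q. *)
Lemma tcoefs_in_cancel fs (D : A) q : D != 0 ->
  tcoefs_in fs (D%:MP * q) -> tcoefs_in fs q.
Proof.
move=> D0 hDq; have [v Dv vmin] : exists2 v, D`_v != 0 & forall j, (j < v)%N -> D`_j = 0.
  have ex : exists v, D`_v != 0 by exists (size D).-1; rewrite -lead_coefE lead_coef_eq0.
  case: (ex_minnP ex) => v Dv vmin; exists v => // j jv.
  by apply/eqP; apply: contraTT jv; rewrite -leqNgt; apply: vmin.
elim/ltn_ind=> i IH.
have := hDq (v + i)%N; rewrite tcoefM.
have lt : (v < (v + i).+1)%N by lia.
rewrite (bigD1 (Ordinal lt)) //= tcoefC addKn => h.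
have rest : ideal_gen fs (\sum_(j < (v + i).+1 | j != Ordinal lt)
    tcoef j D%:MP * tcoef (v + i - j) q).
  apply: ideal_gen_sum => j; rewrite -val_eqE /= => jv.
  case: (ltnP j v) => [/vmin|] hj; first by rewrite tcoefC hj mul0r; apply: ideal_gen0.
  by apply/ideal_genM/IH; have := ltn_ord j; lia.
have := ideal_genM ((D`_v)^-1)%:MP (ideal_genB h rest).
by rewrite /= addrK mulrA -mpolyCM mulVf // mul1r.
Qed.

(** Field extension is flat. Here a combination over K' is cleared of denominators
and read off coefficientwise in t, and the denominator is then cancelled. *)
Lemma ideal_extP fs q :
  ideal_gen (map ext fs) (to_frac q) <-> tcoefs_in fs q.
Proof.
split; last exact: tcoefs_in_to_frac.
case/ideal_ext_denominator=> D D0 [b hb]; rewrite -rmorphM => /to_frac_inj eqb.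
by apply: (tcoefs_in_cancel D0); rewrite eqb.
Qed.

Lemma ideal_ext_scale fs (D : A) P : D != 0 ->
  ideal_gen (map ext fs) (to_frac D%:MP * P) -> ideal_gen (map ext fs) P.
Proof.
move=> D0 /(ideal_genM ((frac D)^-1)%:MP).
by rewrite to_fracC mulrA -mpolyCM mulVf ?(raddf_eq0 _ frac_inj) // mul1r.
Qed.

Lemma nonzerodivisor_ext f fs :
  nonzerodivisor f fs -> nonzerodivisor (ext f) (map ext fs).
Proof.
move=> nzf P; have [D D0 [q hq]] := clear_denominators P.
move=> /(ideal_genM (to_frac D%:MP)); rewrite mulrA hq extE -rmorphM.
move=> /ideal_extP h; apply: (ideal_ext_scale D0); rewrite hq.
by apply/ideal_extP => i; apply: nzf; rewrite -tcoefM_to_poly; apply: h.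
Qed.

(** With t transcendental, f + t c is a nonzerodivisor as soon as no nonzero class
is killed by both f and c; this is McCoy's theorem after clearing
denominators. *)
Lemma nonzerodivisor_generic f c fs :
    (forall u, ideal_gen fs (u * c) -> ideal_gen fs (u * f) -> ideal_gen fs u) ->
  nonzerodivisor (ext f + to_frac 'X%:MP * ext c) (map ext fs).
Proof.
move=> depth P; have [D D0 [q hq]] := clear_denominators P.
move=> /(ideal_genM (to_frac D%:MP)); rewrite mulrA hq !extE -!(rmorphM, rmorphD) /=.
move=> /ideal_extP h; apply: (ideal_ext_scale D0); rewrite hq.
apply/ideal_extP; have [N hN] := tcoef_bound q.
have eqc i : tcoef i (q * (to_poly f + 'X%:MP * to_poly c)) =
    tcoef i q * f + (if i is j.+1 then tcoef j q else 0) * c.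
  by rewrite mulrDr mulrCA mulrA raddfD /= !tcoefM_to_poly tcoefMX.
apply: (mccoy_linear depth (n := N)).
- by move=> i /hN ->; apply: ideal_gen0.
- by have := h 0%N; rewrite eqc mul0r addr0.
- by move=> i; have := h i.+1; rewrite eqc.
Qed.

(** The points have coordinates in K, so a polynomial in t vanishes at them exactly
when all its coefficients do. *)
Lemma ideal_ext_vanishing fs (Z : 'rV[K]_m -> Prop) :
  (forall s p, p \is s.+1.-homog -> (forall w, Z w -> peval p w = 0) ->
     ideal_gen fs p) ->
  forall s P, P \is s.+1.-homog ->
    (forall w, Z w -> peval P (map_mx const_frac w) = 0) ->
  ideal_gen (map ext fs) P.
Proof.
move=> hZ s P hP PZ; have [D D0 [q hq]] := clear_denominators P.
apply: (ideal_ext_scale D0); rewrite hq; apply/ideal_extP => i.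
apply: (hZ s) => [|w /PZ Pw].
  apply/dhomogP => mm; rewrite mcoeff_msupp mcoeff_tcoef => nz.
  apply: contraNeq nz => /(dhomog_nemf_coeff hP) P0.
  have /mpolyP/(_ mm) := hq; rewrite to_fracC mcoeffCM P0 mulr0.
  rewrite mcoeff_map_mpoly => /esym/eqP.
  by rewrite (raddf_eq0 _ frac_inj) => /eqP ->; rewrite coef0.
have : q.@[@polyC K \o (fun j => w 0 j)] = 0.
  apply: frac_inj; rewrite rmorph0 -meval_map -[map_mpoly _ _]/(to_frac q) -hq mevalM.
  rewrite [X in _ * X](_ : _ = 0) ?mulr0 //.
  by rewrite -[RHS]Pw; apply: meval_eq => j; rewrite mxE.
have [N hN] := tcoef_bound q; rewrite {1}(tcoef_expand hN) raddf_sum /=.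
under eq_bigr => j _ do
  rewrite mevalM mevalC -/(to_poly _) meval_map mulrC mul_polyC.
rewrite -(poly_def N (fun j => (tcoef j q).@[fun k => w 0 k])).
move=> /polyP/(_ i); rewrite coef_poly coef0 /peval; case: ltnP => // Ni _.
by rewrite hN // meval0.
Qed.

End TranscendentalExtension.

(** * Counting the points off a hypersurface *)

(** Realized by the field of rational functions, which is determined up to
isomorphism by these two properties. *)
Lemma transcendental_extension (K : fieldType) :
  exists (K' : fieldType) (frac : {rmorphism {poly K} -> K'}),
    injective frac /\
    forall x, exists2 d, d != 0 & exists c, frac d * x = frac c.
Proof.
exists {fraction {poly K}}, (@FracField.tofrac {poly K}); split.
  by move=> p q /eqP; rewrite tofrac_eq => /eqP.
exact: fraction_denominator.
Qed.

Lemma homog_map_mpoly (K K' : fieldType) (f : {rmorphism K -> K'}) m d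
    (p : {mpoly K[m]}) : p \is d.-homog -> map_mpoly f p \is d.-homog.
Proof.
move=> /dhomogP hp; apply/dhomogP => mm.
by rewrite (perm_mem (msupp_map_mpoly _ (fmorph_inj f))) => /hp.
Qed.

Lemma peval_map (K K' : fieldType) (f : {rmorphism K -> K'}) m
    (p : {mpoly K[m]}) (w : 'rV_m) :
  peval (map_mpoly f p) (map_mx f w) = f (peval p w).
Proof. by rewrite /peval -meval_map; apply: meval_eq => j; rewrite mxE. Qed.

(** The generator f is kept, so a multiple of it may be added to g. *)
Lemma ideal_gen_transvection (A : comNzRingType) (f g a : A) (fs gs : seq A) p :
  ideal_gen (f :: fs ++ g :: gs) p <-> ideal_gen (f :: (g + a * f) :: fs ++ gs) p.
Proof.
split; apply: ideal_gen_sub => h.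
  rewrite !(inE, mem_cat) => /or4P[] hh; try by
    apply: ideal_gen_mem; rewrite !(inE, mem_cat) hh ?orbT.
  have -> : h = (g + a * f) - a * f by rewrite (eqP hh) addrK.
  apply: ideal_genB.
    by apply: ideal_gen_mem; rewrite !(inE, mem_cat) eqxx orbT.
  by apply/ideal_genM/ideal_gen_mem; rewrite mem_head.
rewrite !(inE, mem_cat) => /or4P[] hh; try by
  apply: ideal_gen_mem; rewrite !(inE, mem_cat) hh ?orbT.
rewrite (eqP hh); apply: ideal_genD.
  by apply: ideal_gen_mem; rewrite !(inE, mem_cat) eqxx !orbT.
by apply/ideal_genM/ideal_gen_mem; rewrite mem_head.
Qed.

Lemma eq_ideal_gen_cons (A : comNzRingType) (f : A) (fs gs : seq A) :
  (forall p, ideal_gen fs p <-> ideal_gen gs p) ->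
  forall p, ideal_gen (f :: fs) p <-> ideal_gen (f :: gs) p.
Proof.
move=> eqI p; rewrite !ideal_gen_cons.
by split=> -[a /eqI ha]; exists a.
Qed.

Section Counting.
Variables (K : fieldType) (n N : nat) (w : 'I_N -> 'rV[K]_n.+1).
Implicit Types (x y : nat * {mpoly K[n.+1]}).
Local Notation Sd s := (dhomog n.+1 K s).

Lemma hilbert_cons_le x y xs s : hilbert (x :: y :: xs) s <= hilbert (x :: xs) s.
Proof.
rewrite /hilbert /= lerD2l lerN2 lez_nat dimvS // addvS //.
exact: addvSr.
Qed.

Definition eval_on (Y : {set 'I_N}) s (q : Sd s) : 'rV[K]_#|Y| :=
  \row_i peval (mpoly_of_dhomog q) (w (enum_val i)).

Lemma eval_on_is_linear Y s : linear (@eval_on Y s).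
Proof.
by move=> a p q; apply/rowP => i; rewrite !mxE /peval -mevalZ -mevalD.
Qed.

HB.instance Definition _ (Y : {set 'I_N}) s :=
  GRing.isLinear.Build K (Sd s) 'rV[K]_#|Y| _ (@eval_on Y s)
    (@eval_on_is_linear Y s).

(** A form q of degree t - x.1 that vanishes at the points where x does not is such
that q x vanishes at all points, hence belongs to the ideal. So the kernel of
evaluation lies in the kernel of multiplication by x on the quotient, and the
image of that multiplication has dimension at most the number of points. *)
Lemma nonvanishing_ge_hilbert x y xs t :
    all positive_form (x :: y :: xs) -> (x.1 <= t)%N ->
    (forall s p, p \is s.+1.-homog -> (forall i, peval p (w i) = 0) ->
       ideal_gen (unzip2 (y :: xs)) p) ->
  hilbert (y :: xs) t - hilbert (x :: xs) t <=
  (#|[set i | peval x.2 (w i) != 0]|)%:Z.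
Proof.
move=> hall xt hZ; have /= /andP[hx hys] := hall.
have [x_gt0 hom_x] := andP hx.
set Y := [set i | _]; pose ev := linfun (@eval_on Y (t - x.1)).
have sub : (lker ev <= linfun (@mul_form K n x t) @^-1: ideal_part (y :: xs) t)%VS.
  apply/subvP => q; rewrite memv_ker lfunE => /eqP evq.
  rewrite -memv_preim lfunE; apply/ideal_partP => //.
  rewrite mul_formE // xt; apply: (hZ t.-1) => [|i].
    rewrite prednK ?(leq_trans x_gt0) // -[X in X.-homog](subnK xt).
    by apply: dhomogM => //; case: (q).
  rewrite /peval mevalM; case: (eqVneq (peval x.2 (w i)) 0) => [Fi|Fi].
    by rewrite -!/(peval _ _) Fi mulr0.
  have iY : i \in Y by rewrite inE.
  have /rowP/(_ (enum_rank_in iY i)) := evq.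
  by rewrite !mxE enum_rankK_in // -!/(peval _ _) => ->; rewrite mul0r.
have dimE := limg_ker_dim ev fullv; rewrite capfv in dimE.
have dimY : (\dim (limg ev) <= #|Y|)%N.
  by apply: leq_trans (dimvS (subvf _)) _; rewrite dimvf /dim /= mul1n.
have arith (u v a b c p k : int) :
    u - (a + b - c) + (p - c) <= v -> a <= p -> b <= k -> u - v <= k by lia.
have := hilbert_cons_le x y xs t; rewrite hilbert_cons {2}/hilbert -dimE PoszD.
by move/arith; apply; rewrite lez_nat // dimvS.
Qed.

(** In large degree both Hilbert functions in [nonvanishing_ge_hilbert] are
products of degrees, which agree except for the factors x.1 and y.1. *)
Lemma nonvanishing_ge_degrees x y xs :
    all positive_form (x :: y :: xs) -> size (y :: xs) = n ->
    regular_hilbert (y :: xs) -> regular_hilbert (x :: xs) ->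
    (forall s p, p \is s.+1.-homog -> (forall i, peval p (w i) = 0) ->
       ideal_gen (unzip2 (y :: xs)) p) ->
  (y.1 * \prod_(z <- xs) z.1 <=
   #|[set i | peval x.2 (w i) != 0%R]| + x.1 * \prod_(z <- xs) z.1)%N.
Proof.
move=> hall szn regy regx hZ.
have [N1 h1] := regular_hilbert_eventually szn regy.
have [N2 h2] := regular_hilbert_eventually (xs := x :: xs) szn regx.
(* Any degree beyond both stabilization bounds in which x has multiples. *)
pose t := (N1 + N2 + x.1)%N.
have := nonvanishing_ge_hilbert hall (leq_addl _ _ : (x.1 <= t)%N) hZ.
rewrite h1 ?h2 /t; try lia.
by rewrite /= !big_cons !big_map; lia.
Qed.

End Counting.

(** * Exchanging a form into a regular sequence *)

Section ExtendForms.
Variables (K K' : fieldType) (n : nat) (frac : {rmorphism {poly K} -> K'}).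
Hypothesis frac_inj : injective frac.
Hypothesis frac_denominator :
  forall x, exists2 d, d != 0 & exists c, frac d * x = frac c.
Implicit Types (x : nat * {mpoly K[n.+1]}) (xs : seq (nat * {mpoly K[n.+1]})).

Definition ext_form x : nat * {mpoly K'[n.+1]} := (x.1, ext n.+1 frac x.2).

Lemma positive_form_ext x : positive_form x -> positive_form (ext_form x).
Proof. by case/andP => x_gt0 hx; rewrite /positive_form x_gt0 homog_map_mpoly. Qed.

Lemma all_positive_form_ext xs :
  all positive_form xs -> all positive_form (map ext_form xs).
Proof. by rewrite all_map; apply: sub_all => x /positive_form_ext. Qed.

Lemma unzip2_ext xs : unzip2 (map ext_form xs) = map (ext n.+1 frac) (unzip2 xs).
Proof. by rewrite /unzip2 -!map_comp. Qed.

Lemma unzip1_ext xs : unzip1 (map ext_form xs) = unzip1 xs.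
Proof. by rewrite /unzip1 -!map_comp. Qed.

Lemma regular_hilbert_ext xs : all positive_form xs ->
  regular_hilbert xs -> regular_hilbert (map ext_form xs).
Proof.
elim: xs => [|x xs IH] /=; first by move=> _ _; apply: regular_hilbert_nil.
case/andP => hx hxs /(regular_hilbert_cons hx hxs)[reg nzx].
apply/regular_hilbert_cons; rewrite ?positive_form_ext ?all_positive_form_ext //.
split; first exact: IH.
by rewrite unzip2_ext; apply: nonzerodivisor_ext.
Qed.

End ExtendForms.

Lemma perm_move_last (T : eqType) (b c : T) (s t : seq T) :
  perm_eq (b :: s ++ c :: t) (t ++ b :: c :: s).
Proof. by apply/permP => a; rewrite /= !count_cat /=; lia. Qed.

Lemma perm_move_first (T : eqType) (a b c : T) (s t : seq T) :
  perm_eq (a :: b :: s ++ c :: t) (b :: t ++ a :: c :: s).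
Proof. by apply/permP => p; rewrite /= !count_cat /=; lia. Qed.

(** The list gs contains the forms already exchanged, so that F :: gs is regular,
and todo those still to be treated. One step passes from K to K(t) and replaces
the first form y of todo by y + t l^e f1, where e equalizes degrees. The ideal
of f1, gs and todo is not affected; what has to be checked is that the new
form is a nonzerodivisor modulo F :: gs. *)
Lemma nonvanishing_bound n N r : forall (K : fieldType) (w : 'I_N -> 'rV[K]_n.+1)
    (l f1 F : nat * {mpoly K[n.+1]}) (gs todo : seq (nat * {mpoly K[n.+1]})),
    size todo = r -> (size gs + size todo).+1 = n ->
    l.1 = 1%N -> all (fun x => f1.1 <= x.1)%N todo ->
    all positive_form (l :: f1 :: F :: gs ++ todo) ->
    regular_hilbert (l :: f1 :: gs ++ todo) ->
    regular_hilbert (F :: gs) ->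
    (forall s p, p \is s.+1.-homog -> (forall i, peval p (w i) = 0) ->
       ideal_gen (unzip2 (f1 :: gs ++ todo)) p) ->
  (f1.1 * \prod_(z <- gs ++ todo) z.1 <=
   #|[set i | peval F.2 (w i) != 0%R]| + F.1 * \prod_(z <- gs ++ todo) z.1)%N.
Proof.
elim: r => [|r IH] K w l f1 F gs [|y todo] //= => [_ szn|[szt] szn] l1.
  rewrite cats0 => _ /and4P[hl hf hF hgs] reg regF hZ.
  have hall : all positive_form (F :: f1 :: gs) by rewrite /= hF hf.
  apply: (nonvanishing_ge_degrees hall) => //; first by rewrite /= -[RHS]szn addn0.
  have hfg : all positive_form (f1 :: gs) by rewrite /= hf.
  by case: ((regular_hilbert_cons hl hfg).1 reg).
case/andP=> fy lef; rewrite all_cat /= => /and5P[hl hf hF hgs /andP[hy htodo]].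
move=> reg regF hZ.
have [K' [frac [frac_inj frac_den]]] := transcendental_extension K.
pose e := (y.1 - f1.1)%N; pose c := l.2 ^+ e * f1.2.
have [_ hom_l] := andP hl; have [f_gt0 hom_f] := andP hf.
have [y_gt0 hom_y] := andP hy.
have hom_c : c \is (y.1).-homog.
  have := dhomogM (dhomogMn e hom_l) hom_f.
  by rewrite l1 mul1n subnK.
pose E := ext n.+1 frac; pose EF := ext_form (n := n) frac.
pose a := to_frac n.+1 frac 'X%:MP * E (l.2 ^+ e).
pose g := (y.1, E y.2 + a * E f1.2).
have gE : g.2 = E y.2 + to_frac n.+1 frac 'X%:MP * E c.
  by rewrite /g /a /c /= -!mulrA rmorphM.
have hom_g : g.2 \is g.1.-homog.
  rewrite gE; apply: rpredD; first exact: homog_map_mpoly.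
  rewrite to_fracC mul_mpolyC; apply: rpredZ; exact: homog_map_mpoly.
have hg : positive_form g by rewrite /positive_form y_gt0 hom_g.
have hpos xs : all positive_form xs -> all positive_form (map EF xs).
  exact: all_positive_form_ext.
have eqI p : ideal_gen (unzip2 (map EF (f1 :: gs ++ y :: todo))) p <->
             ideal_gen (unzip2 (EF f1 :: g :: map EF gs ++ map EF todo)) p.
  rewrite map_cons map_cat /unzip2 map_cons map_cat /= map_cat.
  exact: ideal_gen_transvection.
pose w' i := map_mx (const_frac frac) (w i).
have hgt : all positive_form (gs ++ y :: todo) by rewrite all_cat hgs /= hy.
have hlf : all positive_form (l :: f1 :: gs ++ y :: todo) by rewrite /= hl hf.
have := IH K' w' (EF l) (EF f1) (EF F) (g :: map EF gs) (map EF todo).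
have -> : (\prod_(z <- (g :: map EF gs) ++ map EF todo) z.1 =
           \prod_(z <- gs ++ y :: todo) z.1)%N.
  rewrite /= big_cons -map_cat big_map !big_cat big_cons /=.
  by rewrite mulnCA.
have -> : #|[set i | peval (EF F).2 (w' i) != 0]| =
          #|[set i | peval F.2 (w i) != 0]|.
  apply: eq_card => i; rewrite !inE peval_map fmorph_eq0 //.
apply => //.
- by rewrite size_map.
- by rewrite /= !size_map -[RHS]szn addSnnS.
- by rewrite all_map.
- rewrite /= all_cat hg !hpos //= !andbT.
  by rewrite !positive_form_ext.
- apply: eq_regular_hilbert (regular_hilbert_ext frac_inj frac_den hlf reg).
  + exact: all_positive_form_ext.
  + rewrite /= all_cat hg !hpos //= !andbT.
    by rewrite !positive_form_ext.
  + rewrite unzip1_ext /unzip1 /= !map_cat /= -!map_comp !perm_cons.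
    by rewrite perm_catC /= perm_cons perm_catC.
  + by move=> p; apply: eq_ideal_gen_cons.
- have hFg : all positive_form (F :: gs) by rewrite /= hF.
  apply: (@regular_hilbert_perm _ _ (g :: map EF (F :: gs))).
  + by rewrite /= hg positive_form_ext ?hpos.
  + by rewrite (perm_catCA [:: _] [:: _]).
  apply/regular_hilbert_cons => //; first exact: hpos.
  split; first exact: regular_hilbert_ext.
  have [_ nzF] := (regular_hilbert_cons hF hgs).1 regF.
  have hyg : all positive_form (y :: gs) by rewrite /= hy.
  have regl : regular_hilbert (l :: y :: gs).
    apply: (@regular_hilbert_catr _ _ (f1 :: todo)).
      by rewrite /= hf all_cat htodo /= hl hy.
    apply: regular_hilbert_perm reg => //.
    exact: perm_move_first.
  have regf : regular_hilbert (f1 :: y :: gs).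
    apply: (@regular_hilbert_catr _ _ (l :: todo)).
      by rewrite /= hl all_cat htodo /= hf hy.
    apply: regular_hilbert_perm reg => //.
    by rewrite perm_cons; apply: perm_move_last.
  have [regy nzl] := (regular_hilbert_cons hl hyg).1 regl.
  have [_ nzf] := (regular_hilbert_cons hf hyg).1 regf.
  have [_ nzy] := (regular_hilbert_cons hy hgs).1 regy.
  rewrite gE unzip2_ext.
  apply: (nonzerodivisor_generic frac_inj frac_den).
  apply: colon_pair nzF nzy _.
  by apply: nonzerodivisorM => //; apply: nonzerodivisorX.
- move=> s p hp pw; apply/eqI; rewrite unzip2_ext.
  apply: (ideal_ext_vanishing frac_inj frac_den (Z := fun v => exists i, v = w i)) hp _.
    move=> s' p' hp' pw'; apply: hZ hp' _ => i; apply: pw'; by exists i.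
  by move=> _ [i ->]; apply: pw.
Qed.

(** * A graded Nullstellensatz *)

Section LinearDependence.
Variables (K : fieldType) (n D s : nat) (u : nat -> {mpoly K[n.+1]}).
Local Notation Sd := (dhomog n.+1 K s).

Definition combination (c : 'rV[K]_D.+1) : Sd :=
  \sum_(a < D.+1) c 0 a *: homog_part s (u a).

Lemma combination_is_linear : linear combination.
Proof.
move=> a c e; rewrite /combination scaler_sumr -big_split.
by apply: eq_bigr => i _; rewrite !mxE scalerDl scalerA.
Qed.

HB.instance Definition _ :=
  GRing.isLinear.Build K 'rV[K]_D.+1 Sd _ combination combination_is_linear.

(** More forms than the dimension of the quotient are linearly dependent in it. The
coefficients are returned as a polynomial because they are used as those of a
binary form. *)
Lemma hilbert_dependence xs :
    all positive_form xs -> hilbert xs s <= D%:Z ->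
    (forall a, (a <= D)%N -> u a \is s.-homog) ->
  exists P : {poly K}, [/\ P != 0, (size P <= D.+1)%N &
    ideal_gen (unzip2 xs) (\sum_(a < D.+1) P`_a *: u a)].
Proof.
move=> hxs hD hu; pose V := ideal_part xs s; pose f := linfun combination.
have [pre0|pre_neq0] := eqVneq (f @^-1: V)%VS 0%VS.
  have ker0 : (lker f = 0)%VS.
    by apply/eqP; rewrite -subv0 -pre0 -lpreim0 lpreimS ?sub0v.
  have dimf : \dim (limg f) = D.+1.
    by rewrite limg_dim_eq ?ker0 ?capv0 // dimvf /dim /= mul1n.
  have cap0 : (limg f :&: V = 0)%VS.
    rewrite capvC -(lpreimK (capvSr V (limg f))) lpreim_cap_limg pre0.
    exact: limg0.
  have := dimvS (subvf (limg f + V)); rewrite dimv_disjoint_sum // dimf.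
  move: hD; rewrite /hilbert -/V => h1 h2; exfalso.
  move: h1 h2; move: (\dim V) (\dim _) => a b; lia.
set c := vpick (f @^-1: V).
have c_in : c \in (f @^-1: V)%VS by apply: memv_pick.
have c0 : c != 0 by rewrite vpick0.
exists (rVpoly c); split; last 1 first.
- move: c_in; rewrite -memv_preim lfunE => /(ideal_partP _ hxs).
  rewrite /= /combination raddf_sum /=; congr (ideal_gen _ _).
  apply: eq_bigr => a _; rewrite coef_rVpoly_ord -[in RHS](homog_partE (hu a _)) //.
  by rewrite -ltnS.
- apply: contraNneq c0 => h; apply/eqP; rewrite -[c]rVpolyK h.
  exact: raddf0.
- exact: size_poly.
Qed.

End LinearDependence.

Section BinaryForms.
Variables (K : fieldType) (m : nat) (x z : {mpoly K[m]}).

(** The binary form of degree D in x and z whose value at z = 1 is P. *)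
Definition homogenization D (P : {poly K}) : {mpoly K[m]} :=
  \sum_(a < D.+1) P`_a *: (x ^+ a * z ^+ (D - a)).

Lemma homogenization_factor D (Q : {poly K}) lam : (size Q <= D.+1)%N ->
  homogenization D.+1 (Q * ('X - lam%:P)) = (x - lam *: z) * homogenization D Q.
Proof.
move=> szQ; rewrite /homogenization mulrBr mulrBl !mulr_sumr.
have -> : \sum_(a < D.+2) (Q * 'X - Q * lam%:P)`_a *: (x ^+ a * z ^+ (D.+1 - a)) =
   \sum_(a < D.+2) (Q * 'X)`_a *: (x ^+ a * z ^+ (D.+1 - a)) -
   \sum_(a < D.+2) (Q * lam%:P)`_a *: (x ^+ a * z ^+ (D.+1 - a)).
  by rewrite -sumrB; apply: eq_bigr => a _; rewrite coefB scalerBl.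
congr (_ - _).
  rewrite big_ord_recl coefMX eqxx scale0r add0r; apply: eq_bigr => a _.
  by rewrite lift0 coefMX /= subSS exprS -scalerAr mulrA.
rewrite big_ord_recr /= coefMC [Q`_D.+1]nth_default // mul0r scale0r addr0.
apply: eq_bigr => a _; rewrite coefMC subSn; last by rewrite -ltnS.
by rewrite exprS -scalerAr -scalerAl scalerA; congr (_ *: _); ring.
Qed.

Lemma homogenization_homog D P : x \is 1.-homog -> z \is 1.-homog ->
  homogenization D P \is D.-homog.
Proof.
move=> hx hz; apply: rpred_sum => a _; apply: rpredZ.
have := dhomogM (dhomogMn a hx) (dhomogMn (D - a) hz).
by rewrite !mul1n subnKC // -ltnS.
Qed.

End BinaryForms.

Section Torsion.
Variables (L : closedFieldType) (m : nat) (gs : seq {mpoly L[m]}).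
Variables (z p : {mpoly L[m]}).
Local Notation S := {mpoly L[m]}.
Local Notation y := (z * p).
Implicit Types (u v f x : S).

(** Membership in the saturation of the ideal by z p. Both z and p become
nonzerodivisors modulo the saturation ([torsionXz], [torsionXp]). *)
Definition torsion u := exists M, ideal_gen gs (y ^+ M * u).

Lemma torsionM u v : torsion u -> torsion (v * u).
Proof. by case=> M h; exists M; rewrite mulrCA; apply: ideal_genM. Qed.

Lemma torsionD u v : torsion u -> torsion v -> torsion (u + v).
Proof.
case=> M h [M' h']; exists (M + M')%N.
have -> : y ^+ (M + M') * (u + v) = y ^+ M' * (y ^+ M * u) + y ^+ M * (y ^+ M' * v).
  by rewrite exprD; ring.
by apply: ideal_genD; apply: ideal_genM.
Qed.

Lemma torsionXz a u : torsion (z ^+ a * u) -> torsion u.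
Proof.
case=> M /(ideal_genM (p ^+ a)) h; exists (M + a)%N; move: h.
congr (ideal_gen _ _); rewrite exprD [y ^+ a]exprMn.
by move: (y ^+ M) (z ^+ a) (p ^+ a) => b c d; ring.
Qed.

Lemma torsionXp a u : torsion (p ^+ a * u) -> torsion u.
Proof.
case=> M /(ideal_genM (z ^+ a)) h; exists (M + a)%N; move: h.
congr (ideal_gen _ _); rewrite exprD [y ^+ a]exprMn.
by move: (y ^+ M) (z ^+ a) (p ^+ a) => b c d; ring.
Qed.

Lemma torsionZ c u : c != 0 -> torsion (c *: u) -> torsion u.
Proof.
move=> c0 /(torsionM (c^-1)%:MP).
by rewrite mul_mpolyC scalerA mulVf // scale1r.
Qed.

(** Over an algebraically closed field the binary form is a product of linear
factors and of powers of z. Multiply u by these factors one after the other: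
the product becomes torsion at some factor, and it is not a power of z, which is
a nonzerodivisor. *)
Lemma linear_torsion x D (P : {poly L}) u :
    x \is 1.-homog -> z \is 1.-homog -> P != 0 -> (size P <= D.+1)%N ->
    ~ torsion u -> torsion (homogenization x z D P * u) ->
  exists lam d v, [/\ v \is d.-homog, ~ torsion (v * u) &
    torsion ((x - lam *: z) * (v * u))].
Proof.
move=> hx hz; have const0 (Q : {poly L}) : Q != 0 -> (size Q <= 1)%N -> Q`_0 != 0.
  by move=> Q0 szQ; apply: contraNneq Q0 => e; rewrite (size1_polyC szQ) e.
elim: D P => [|D IH] P P0 szP Tu.
  rewrite /homogenization big_ord1 subn0 !expr0 mulr1 -scalerAl mul1r.
  by move/(torsionZ (const0 _ P0 szP)).
have [szP1|szP1] := leqP (size P) 1.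
  have -> : homogenization x z D.+1 P = P`_0 *: z ^+ D.+1.
    rewrite /homogenization big_ord_recl expr0 mul1r subn0 big1 ?addr0 // => a _.
    by rewrite (size1_polyC szP1) coefC /= scale0r.
  by rewrite -scalerAl => /(torsionZ (const0 _ P0 szP1))/torsionXz.
have [lam /factor_theorem[Q PE]] : exists lam, root P lam.
  by apply/closed_rootP; rewrite gtn_eqF.
have Q0 : Q != 0 by apply: contraNneq P0 => e; rewrite PE e mul0r.
have szQ : (size Q <= D.+1)%N.
  by move: szP; rewrite PE size_Mmonic ?monicXsubC // size_XsubC addn2.
rewrite PE homogenization_factor // -mulrA => tor.
case: (classic (torsion (homogenization x z D Q * u))) => [|ntor].
  exact: IH.
exists lam, D, (homogenization x z D Q); split=> //.
exact: homogenization_homog.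
Qed.

Variable u : S.
(** Congruence modulo the annihilator of u in the quotient by the saturated
ideal. *)
Definition congruent f g := torsion ((f - g) * u).

Lemma congruentM f g f' g' :
  congruent f g -> congruent f' g' -> congruent (f * f') (g * g').
Proof.
move=> h h'; rewrite /congruent.
have -> : (f * f' - g * g') * u = f' * ((f - g) * u) + g * ((f' - g') * u) by ring.
by apply: torsionD; apply: torsionM.
Qed.

Lemma congruent_refl f : congruent f f.
Proof. by exists 0%N; rewrite subrr mul0r mulr0; apply: ideal_gen0. Qed.

Lemma congruentX f g a : congruent f g -> congruent (f ^+ a) (g ^+ a).
Proof.
move=> h; elim: a => [|a IH]; first exact: congruent_refl.
by rewrite !exprS; apply: congruentM.
Qed.

Lemma congruent_eval d f (w : 'rV[L]_m) :
    (forall i, congruent 'X_i (w 0 i *: z)) -> f \is d.-homog ->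
  congruent f (peval f w *: z ^+ d).
Proof.
move=> hw /dhomogP hf.
have mon mm : congruent 'X_[mm] ((\prod_i w 0 i ^+ mm i) *: z ^+ mdeg mm).
  rewrite mpolyXE_id mdegE -prodrXr -scaler_prod.
  elim/big_ind2: _ => [|f1 g1 f2 g2|i _]; first exact: congruent_refl.
    exact: congruentM.
  by rewrite -exprZn; apply: congruentX.
rewrite /congruent {1}[f]mpolyE /peval mevalE scaler_suml -sumrB mulr_suml.
rewrite big_seq; apply: big_ind => [||mm mmf].
- by rewrite -(mul0r u) -(subrr 0); apply: congruent_refl.
- exact: torsionD.
rewrite -(hf _ mmf) /= -scalerA -scalerBr -scalerAl -mul_mpolyC.
exact/torsionM/mon.
Qed.

End Torsion.

Section Nullstellensatz.
Variables (L : closedFieldType) (n N D : nat).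
Variables (xs : seq (nat * {mpoly L[n.+1]})).
Local Notation S := {mpoly L[n.+1]}.
Local Notation I := (ideal_gen (unzip2 xs)).
Hypothesis hxs : all positive_form xs.
Hypothesis hD : forall s, (N <= s)%N -> hilbert xs s <= D%:Z.

(** The class of u generates a module on which every coordinate x_i acts as a scalar
multiple of x_j, so w is a point with w_j = 1. Coordinates are treated
in turn: as the Hilbert function is at most D in large degrees, the D + 1
products x_i^a x_j^(D - a) x_j^N u are dependent, and a linear factor of the
resulting binary form gives the next scalar and the next multiple of u. *)
Lemma torsion_point (j : 'I_n.+1) (p : S) :
    ~ torsion (unzip2 xs) 'X_j p 1 ->
  exists (w : 'rV[L]_n.+1) (u : S), ~ torsion (unzip2 xs) 'X_j p u /\
    forall i, congruent (unzip2 xs) 'X_j p u 'X_i (w 0 i *: 'X_j).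
Proof.
set T := torsion (unzip2 xs) 'X_j p => nT1.
have homX (i : 'I_n.+1) : 'X_i \is [in L[n.+1], 1.-homog] by rewrite dhomogX /= mdeg1.
have homXn e : 'X_j ^+ e \is [in L[n.+1], e.-homog].
  by have := dhomogMn e (homX j); rewrite mul1n.
suff: forall r : seq 'I_n.+1, exists (w : 'I_n.+1 -> L) u d, [/\ u \is d.-homog, ~ T u &
    forall i, i \in r -> T (('X_i - w i *: 'X_j) * u)].
  move=> /(_ (enum 'I_n.+1))[w [u [d [_ nTu hw]]]].
  exists (\row_i w i), u; split=> // i.
  by rewrite /congruent mxE; apply: hw; rewrite mem_enum.
elim=> [|i r [w [u [d [hu nTu hw]]]]].
  by exists (fun=> 0), 1, 0%N; split=> //; apply: dhomog1.
(* The factor 'X_j ^+ N brings the degree into the range of the bound. *)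
pose v := 'X_j ^+ N * u.
have nTv : ~ T v by move/torsionXz.
pose t a : S := 'X_i ^+ a * 'X_j ^+ (D - a) * v.
have ht a : (a <= D)%N -> t a \is (D + (N + d)).-homog.
  move=> aD; apply: dhomogM; last first.
    exact: dhomogM (homXn N) hu.
  have := dhomogM (dhomogMn a (homX i)) (dhomogMn (D - a) (homX j)).
  by rewrite !mul1n subnKC.
have ge : (N <= D + (N + d))%N by lia.
have [P [P0 szP hP]] := hilbert_dependence hxs (hD ge) ht.
have tor : T (homogenization 'X_i 'X_j D P * v).
  exists 0%N; rewrite expr0 mul1r /homogenization mulr_suml.
  by under eq_bigr do rewrite -scalerAl.
have [lam [e [f [hf nTf hlam]]]] := linear_torsion (homX i) (homX j) P0 szP nTv tor.
exists (fun k => if k == i then lam else w k), (f * v), (e + (N + d))%N; split=> //.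
  exact: dhomogM hf (dhomogM (homXn N) hu).
move=> k; rewrite inE; case: eqP => [-> _ //|_ /hw h].
rewrite (_ : _ * _ = f * 'X_j ^+ N * (('X_k - w k *: 'X_j) * u)).
  exact: torsionM.
by rewrite /v; ring.
Qed.

(** In positive degree p is a combination of the coordinates, so p^2 belongs to the
ideal together with the products x_j p. A nonzero constant is excluded because
the ideal has no linear forms. *)
Lemma radical_saturated (p : S) s :
    radical_ideal I -> all (fun x => 2 <= x.1)%N xs -> p \is s.-homog ->
  (forall j : 'I_n.+1, I ('X_j * p)) -> I p.
Proof.
move=> rad deg2; case: s => [|s] hp hX.
  suff -> : p = 0 by apply: ideal_gen0.
  have pC : p = (p@_0)%:MP.
    apply/mpolyP => mm; rewrite mcoeffC; case: eqP => [->|/eqP mm0]; first by rewrite mulr1.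
    by rewrite mulr0 (dhomog_nemf_coeff hp) // mdeg_eq0.
  have := ideal_gen_low_degree hxs deg2 (hX ord0); rewrite pihomog_dE; last first.
    by rewrite pC mulrC mul_mpolyC; apply: rpredZ; rewrite dhomogX /= mdeg1.
  move=> /eqP; rewrite mulf_eq0 => /orP[|/eqP //].
  by rewrite -msize_poly_eq0 msizeX.
(* Expand one of the two factors of p ^+ 2 into monomials. *)
apply: (rad p 2); rewrite expr2 {1}[p]mpolyE mulr_suml big_seq.
apply: ideal_gen_sum => mm /(dhomogP _ _ _ hp) => dm.
have [j mj] : exists j, (0 < mm j)%N.
  apply/existsP; apply: contraT => /existsPn h.
  by move: dm; rewrite /= mdegE big1 // => j _; apply/eqP; rewrite -leqn0 leqNgt.
have -> : mm = (mm - U_(j) + U_(j))%MM by rewrite submK // lep1mP -lt0n.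
rewrite mpolyXD -scalerAl -mulrA -mul_mpolyC; do 2!apply: ideal_genM.
exact: hX.
Qed.

(** If some x_j p is not in the ideal, no power of it is, by radicality. The point
obtained from [torsion_point] is then a zero of the ideal, since f u is
congruent to f(w) x_j^d u for every form f of degree d, and for the same reason
p does not vanish there. *)
Lemma graded_nullstellensatz s (p : S) :
    radical_ideal I -> all (fun x => 2 <= x.1)%N xs -> p \is s.-homog ->
    (forall w : 'rV[L]_n.+1, w != 0 -> (forall g, g \in unzip2 xs -> peval g w = 0) ->
       peval p w = 0) ->
  I p.
Proof.
move=> rad deg2 hp hV; apply: (radical_saturated rad deg2 hp) => j.
apply: NNPP => nI.
have nT1 : ~ torsion (unzip2 xs) 'X_j p 1.
  by case=> M; rewrite mulr1 => /rad.
have [w [u [nTu hw]]] := torsion_point nT1.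
have homX : 'X_j \is [in L[n.+1], 1.-homog] by rewrite dhomogX /= mdeg1.
have zero d f : f \is d.-homog -> torsion (unzip2 xs) 'X_j p (f * u) -> peval f w = 0.
  move=> hf Tf; have cong := congruent_eval hw hf.
  apply/eqP; apply: NNPP => /negP nz; apply: nTu.
  apply: (torsionXz (a := d)); apply: (torsionZ nz).
  rewrite (_ : _ *: _ = f * u + (-1) * ((f - peval f w *: 'X_j ^+ d) * u)).
    by apply: torsionD => //; apply: torsionM.
  by rewrite scalerAl; ring.
have w0 : w != 0.
  apply/eqP => w0; apply: nTu; apply: (torsionXz (a := 1)).
  by have := hw j; rewrite /congruent w0 mxE scale0r subr0.
have pw : peval p w = 0.
  apply: hV => // g /mapP[x xin ->]; have /andP[_ hx] := allP hxs x xin.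
  apply: (zero _ _ hx); exists 0%N; rewrite expr0 mul1r mulrC; apply: ideal_genM.
  by apply: ideal_gen_mem; apply: map_f.
apply: nTu; apply: (torsionXp (a := 1)); rewrite expr1.
by have := congruent_eval hw hp; rewrite /congruent pw scale0r subr0.
Qed.

End Nullstellensatz.

(** * From points to the minimum distance *)

Lemma peval_scale (K : fieldType) m d (p : {mpoly K[m]}) (c : K) (w : 'rV_m) :
  p \is d.-homog -> peval p (c *: w) = c ^+ d * peval p w.
Proof.
move=> /dhomogP hp; rewrite /peval !mevalE mulr_sumr !big_seq.
apply: eq_bigr => mm /hp <-; rewrite /= mdegE -prodrXr mulrCA -big_split.
by congr (_ * _); apply: eq_bigr => i _; rewrite mxE exprMn.
Qed.

Lemma peval_ideal (K : fieldType) m (gs : seq {mpoly K[m]}) q (w : 'rV_m) :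
  (forall g, g \in gs -> peval g w = 0) -> ideal_gen gs q -> peval q w = 0.
Proof.
move=> hg [a ->]; rewrite /peval raddf_sum big1 // => i _.
by rewrite /= mevalM -!/(peval _ _) (hg _ (mem_nth 0 (ltn_ord i))) mulr0.
Qed.

(** Take coefficients 1, c, c^2, ...: a vector then becomes the value at c of a
nonzero polynomial, and over an infinite field some c is a root of none of
them. *)
Lemma avoiding_linear_form (L : closedFieldType) n N (w : 'I_N -> 'rV[L]_n) :
  (forall i, w i != 0) ->
  exists2 l : {mpoly L[n]}, l \is 1.-homog & forall i, peval l (w i) != 0.
Proof.
move=> w0; pose P := \prod_i rVpoly (w i).
have P0 : P != 0.
  apply/prodf_neq0 => i _; apply: contraNneq (w0 i) => e.
  by rewrite -[w i]rVpolyK e raddf0.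
have [c rootc] : exists c, ~~ root P c by apply/closed_nonrootP.
exists (\sum_(j < n) c ^+ j *: 'X_j).
  by apply: rpred_sum => j _; apply: rpredZ; rewrite dhomogX /= mdeg1.
move=> i; suff -> : peval (\sum_(j < n) c ^+ j *: 'X_j) (w i) = (rVpoly (w i)).[c].
  by move: rootc; rewrite /root horner_prod prodf_seq_neq0 => /allP; apply; rewrite mem_index_enum.
rewrite /peval raddf_sum /= (horner_coef_wide _ (size_poly _ _)).
by apply: eq_bigr => j _; rewrite mevalZ mevalXU coef_rVpoly_ord mulrC.
Qed.

(** The Nullstellensatz identifies the ideal with the forms that vanish at the
points. In particular a linear form without zeros among the points is a
nonzerodivisor modulo the ideal, which provides the form that
[nonvanishing_bound] uses to equalize degrees. *)
Lemma nonvanishing_complete_intersection (L : closedFieldType) n N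
    (w : 'I_N -> 'rV[L]_n.+1) (f F : nat * {mpoly L[n.+1]}) xs :
    size (f :: xs) = n -> all positive_form (F :: f :: xs) -> F.2 != 0 ->
    all (fun x => 2 <= x.1)%N (f :: xs) -> all (fun x => f.1 <= x.1)%N xs ->
    regular_sequence (unzip2 (f :: xs)) ->
    radical_ideal (ideal_gen (unzip2 (f :: xs))) ->
    (forall i, w i != 0) ->
    (forall i g, g \in unzip2 (f :: xs) -> peval g (w i) = 0) ->
    (forall v : 'rV[L]_n.+1, v != 0 ->
       (forall g, g \in unzip2 (f :: xs) -> peval g v = 0) ->
       exists i, proj_eq v (w i)) ->
  (f.1 * \prod_(z <- xs) z.1 <=
   #|[set i | peval F.2 (w i) != 0%R]| + F.1 * \prod_(z <- xs) z.1)%N.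
Proof.
move=> szys hall F0 deg2 lef regs rad w0 zw hw.
set ys := f :: xs in szys deg2 regs rad zw hw *.
have [hF hys] : positive_form F /\ all positive_form ys by apply/andP.
have reg := regular_sequence_hilbert hys regs.
have [M hM] := regular_hilbert_eventually szys reg.
have hD s : (M <= s)%N -> hilbert ys s <= (\prod_(d <- unzip1 ys) d)%N%:Z.
  by move=> Ms; rewrite hM.
have nss := graded_nullstellensatz hys hD rad deg2.
have vanish s p : p \is s.-homog -> (forall i, peval p (w i) = 0) ->
    ideal_gen (unzip2 ys) p.
  move=> hp hpw; apply: (nss _ _ hp) => v v0 /(hw v v0)[i [c _ ->]].
  by rewrite (peval_scale _ _ hp) hpw mulr0.
have [l hl lw] := avoiding_linear_form w0.
have pl : positive_form (1%N, l) by rewrite /positive_form /= hl.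
have regl : regular_hilbert ((1%N, l) :: ys).
  apply/regular_hilbert_cons => //; split=> //.
  apply: homog_nonzerodivisor => // s p hp /= hpl.
  apply: (vanish s) => // i; apply/eqP.
  have : peval (p * l) (w i) = 0 by apply: peval_ideal hpl => g; apply: zw.
  by rewrite /peval mevalM => /eqP; rewrite mulf_eq0 (negPf (lw i)) orbF.
have regF : regular_hilbert [:: F].
  apply/regular_hilbert_cons => //; split; first exact: regular_hilbert_nil.
  move=> p /= /ideal_gen_nil/eqP; rewrite mulf_eq0 (negPf F0) orbF => /eqP ->.
  exact: ideal_gen0.
have [hf hxs] := andP hys.
apply: (@nonvanishing_bound n N (size xs) L w (1%N, l) f F [::] xs) => //=.
- by rewrite /= pl hf hF.
- by move=> s p hp; apply: vanish hp.
Qed.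

Theorem theorem2p3
  (F : finFieldType) (L : closedFieldType) (iota : {rmorphism F -> L})
  (iotaP : algebraic_closure iota)
  (r : nat) (r_gt0 : (0 < r)%N)
  (ds : r.-tuple nat)
  (ds_ge2 : forall i : 'I_r, (2 <= tnth ds i)%N)
  (ds_sorted : sorted leq ds)
  (d : nat) (d_gt0 : (0 < d)%N)
  (n : nat) (v : 'I_n -> 'rV[F]_r.+1)
  (vP : reduced_ci_points iota ds v) :
  ((nth 0 ds 0 - minn d (nth 0 ds 0)) * \prod_(1 <= i < r) nth 0 ds i
     <= min_distance (evaluation_code d v))%N.
Proof.
case: vP => v0 _ [fs]; cbv zeta; set gs := map _ _ => -[hfs regs rad zeros].
have [_|ltd] := leqP (nth 0%N ds 0) d; first by rewrite subnn mul0n.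
have szgs : size gs = r by rewrite size_map size_tuple.
have szds := size_tuple ds.
have xs1 : unzip1 (zip ds gs) = ds by rewrite unzip1_zip ?szgs ?szds.
have xs2 : unzip2 (zip ds gs) = gs by rewrite unzip2_zip ?szgs ?szds.
have hpos : all positive_form (zip ds gs).
  apply/(all_nthP (0%N, 0)) => i; rewrite size_zip szds szgs minnn => ir.
  rewrite nth_zip ?szds ?szgs // /positive_form /=.
  have := ds_ge2 (Ordinal ir); rewrite (tnth_nth 0%N) /= => /ltnW ->.
  rewrite (nth_map 0) ?size_tuple //; apply: homog_map_mpoly.
  by have := hfs (Ordinal ir); rewrite !(tnth_nth 0).
have deg2 : all (fun x => 2 <= x.1)%N (zip ds gs).
  rewrite -(all_map fst (leq 2)) -/(unzip1 _) xs1; apply/all_tnthP => i.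
  exact: ds_ge2.
pose w i := map_mx iota (v i).
case: (zip ds gs) hpos deg2 xs1 xs2 => [|f1 xs] hpos deg2 xs1 xs2.
  by have : (0 < size ds)%N; rewrite ?szds // -xs1.
have hd : nth 0%N ds 0 = f1.1 by rewrite -xs1.
have hprod : (\prod_(1 <= i < r) nth 0 ds i = \prod_(z <- xs) z.1)%N.
  rewrite -[X in \prod_(1 <= i < X) _]szds -xs1 big_add1 /= (big_nth (0%N, 0)) size_map.
  by apply: eq_big_nat => i /andP[_ ix]; rewrite (nth_map (0%N, 0)).
rewrite hd hprod in ltd *.
have [f1_ge2 xs_ge2] := andP deg2.
have prod_gt0 : (0 < \prod_(z <- xs) z.1)%N.
  rewrite big_seq; apply: prodn_cond_gt0 => z zx.
  by apply: leq_trans (allP xs_ge2 z zx).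
have lef : all (fun x => f1.1 <= x.1)%N xs.
  move: ds_sorted; rewrite -xs1 /= (path_sortedE leq_trans) => /andP[+ _].
  by rewrite all_map.
have w0 i : w i != 0 by rewrite map_mx_eq0.
have szr : size (f1 :: xs) = r by rewrite -[RHS]szds -xs1 /= size_map.
have bound (f : dhomog r.+1 F d) : f != 0 ->
    ((f1.1 - d) * \prod_(z <- xs) z.1 <= hamming_weight (eval_forms v f))%N.
  move=> f0; pose f' := map_mpoly iota (mpoly_of_dhomog f).
  have pf : positive_form (d, f').
    by rewrite /positive_form /= d_gt0 homog_map_mpoly //; case: (f).
  have f'0 : f' != 0.
    apply: contraNneq f0 => e; apply/eqP/val_inj/mpolyP => mm.
    have /mpolyP/(_ mm) := e; rewrite mcoeff_map_mpoly !mcoeff0 => /eqP.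
    by rewrite fmorph_eq0 => /eqP.
  have hall : all positive_form [:: (d, f'), f1 & xs] by rewrite /= pf.
  have zw i g : g \in gs -> peval g (w i) = 0.
    apply: (zeros (w i) (w0 i)).2; exists i, 1; rewrite ?oner_neq0 //.
    by rewrite scale1r.
  have main := nonvanishing_complete_intersection szr hall f'0 deg2 lef.
  rewrite xs2 in main; have {main} := main _ w regs rad w0 zw
    (fun u u0 => (zeros u u0).1).
  rewrite mulnBl leq_subLR addnC; congr (_ <= _ + _)%N.
  by apply: eq_card => i; rewrite !inE peval_map fmorph_eq0 mxE.
(* The code is not zero: by the bound, 'X_ord0 ^+ d has a nonzero codeword. *)
rewrite /min_distance; case: arg_minnP => [|c /andP[]].
  rewrite memv_pick vpick0.
  have hX : 'X_ord0 ^+ d \is [in F[r.+1], d.-homog].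
    by have := dhomogMn d (_ : 'X_ord0 \is [in F[r.+1], 1.-homog]); rewrite mul1n; apply; rewrite dhomogX /= mdeg1.
  have X0 : DHomog hX != 0.
    by apply/eqP => /(congr1 val)/eqP; rewrite /= expf_eq0 -msize_poly_eq0 msizeX andbF.
  apply: contraTneq (bound _ X0) => C0; rewrite -ltnNge.
  have /eqP -> : eval_forms v (DHomog hX) == 0.
    rewrite -memv0 -C0 -[eval_forms _ _](lfunE (eval_forms v)).
    by apply: memv_img; apply: memvf.
  rewrite /hamming_weight (_ : [set i | _] = set0) ?cards0.
    by rewrite muln_gt0 subn_gt0 ltd.
  by apply/setP => i; rewrite !inE mxE eqxx.
case/memv_imgP => f _ ->; rewrite lfunE => ev0 _; apply: bound.
by apply: contraNneq ev0 => ->; rewrite raddf0.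
Qed.
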